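(* Let $\mathcal S,\mathcal T$ be closed subspaces of $\mathcal H$ and $A=P_{\mathcal S}-P_{\mathcal T}$. Then $\mathcal S$ and $\mathcal T$ do not have a common complement if and only if both of the following hold: (1) $\dim N(A-1)\ne\dim N(A+1)$; (2) the restriction $A|_{\mathcal H_0}$ is compact, where $\mathcal H_0=(N(A-1)\oplus N(A+1))^\perp$ (a reducing subspace for $A$).
   Context: $\mathcal H$ is a separable complex Hilbert space; for a closed subspace $\mathcal S$, $P_{\mathcal S}$ is the orthogonal projection onto $\mathcal S$; $N(\cdot)$ denotes null space. Two closed subspaces $\mathcal S,\mathcal T$ have a common complement if there is a closed subspace $\mathcal Z$ with $\mathcal S\cap\mathcal Z=\mathcal T\cap\mathcal Z=\{0\}$ and $\mathcal S+\mathcal Z=\mathcal T+\mathcal Z=\mathcal H$. (Note $N(A-1)=\mathcal S\cap\mathcal T^\perp$ and $N(A+1)=\mathcal S^\perp\cap\mathcal T$.) *)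

(* Defs.v *)
(* mathcomp-analysis (normed modules, topology) over the
   complex numbers R[i] of mathcomp-real-closed, R : realType. *)
From mathcomp Require Import all_boot all_algebra complex.
From mathcomp Require Import all_classical all_reals all_analysis.
Import numFieldNormedType.Exports.
Import GRing.Theory Num.Theory.
Set Implicit Arguments. Unset Strict Implicit. Unset Printing Implicit Defensive.
Local Open Scope ring_scope.
Local Open Scope complex_scope.
Local Open Scope classical_set_scope.

Section Hilbert.
Variable R : realType.
Variable V : completeNormedModType R[i].
Variable ip : V -> V -> R[i].

(* ip is an inner product (linear in the first argument, conjugate symmetric)
   inducing the norm of V; V being complete, (V, ip) is a complex Hilbert space. *)
Definition hilbert_inner : Prop :=
  [/\ (forall (a : R[i]) (x y z : V), ip (a *: x + y) z = a * ip x z + ip y z),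
      (forall x y : V, ip y x = (ip x y)^*) &
      (forall x : V, `|x| ^+ 2 = ip x x)].

(* separability: a countable dense subset *)
Definition separable_space : Prop :=
  exists D : set V, countable D /\ closure D = setT.

Definition subspace (M : set V) : Prop :=
  M 0 /\ forall (a : R[i]) (x y : V), M x -> M y -> M (a *: x + y).

Definition closed_subspace (M : set V) : Prop := subspace M /\ closed M.

(* orthogonal complement *)
Definition orth (M : set V) : set V := [set x | forall y, M y -> ip x y = 0].

(* P is the orthogonal projection onto M *)
Definition is_orth_proj (M : set V) (P : V -> V) : Prop :=
  forall x, M (P x) /\ orth M (x - P x).

(* S and T have a common complement *)
Definition common_complement (S T : set V) : Prop :=
  exists Z : set V, [/\ closed_subspace Z,
    S `&` Z = [set 0], T `&` Z = [set 0],
    (forall x, exists s z, [/\ S s, Z z & x = s + z]) &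
    (forall x, exists t z, [/\ T t, Z z & x = t + z])].

(* e : I -> V is an orthonormal basis of the closed subspace M *)
Definition orthonormal_basis (M : set V) (I : Type) (e : I -> V) : Prop :=
  [/\ (forall i, M (e i)),
      (forall i, ip (e i) (e i) = 1),
      (forall i j, i <> j -> ip (e i) (e j) = 0) &
      (forall x, M x -> (forall i, ip x (e i) = 0) -> x = 0)].

(* dim M = dim N (Hilbert dimensions): M and N have orthonormal bases of the
   same cardinality, i.e. indexed by the same type. *)
Definition same_hdim (M N : set V) : Prop :=
  exists (I : Type) (e f : I -> V), orthonormal_basis M e /\ orthonormal_basis N f.

(* null space of B - c *)
Definition eigspace (B : V -> V) (c : R[i]) : set V := [set x | B x = c *: x].

(* direct sum M (+) N (as a set of sums) *)
Definition setsum (M N : set V) : set V := [set x + y | x in M & y in N].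

(* B restricted to the (closed, B-invariant) subspace M is compact:
   the image of the closed unit ball of M is relatively compact. *)
Definition compact_on (B : V -> V) (M : set V) : Prop :=
  compact (closure (B @` [set x | M x /\ `|x| <= 1])).

End Hilbert.

(* Main.v *)
(** Write M = S ∩ T^⊥, N = T ∩ S^⊥ and A = P_S - P_T.

    A common complement is obtained from a linear relation G between T and S,
    bi-Lipschitz with dense domain and range, such that Re <t, t + s> >= d |t|^2
    and Re <s, t + s> >= d |s|^2 on G: then {t + s}^⊥ is a complement of both.
    If dim M = dim N, pair orthonormal bases of N and M, and pair |B| u with
    P_S u for u in T, where B = P_S + P_T - 1. If A is not compact on
    H0 = (M + N)^⊥, cut H at some spectral value a > 0 of A^2: on the part E
    where A^2 >= a both T ∩ E and S ∩ E are infinite-dimensional, so orthonormal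
    bases of them can be paired, while on E^⊥ the operator P_S is an isomorphism
    from T ∩ E^⊥ to S ∩ E^⊥. Both constructions only need the absolute value of a
    bounded self-adjoint operator.

    Conversely, let Z be a common complement, A compact on H0, and dim N < dim M
    (the other case is symmetric). With Q the projection onto T along Z and W an
    isometry of N into M that is not onto, Q (P_S + W P_N) is on T an injective,
    non-surjective perturbation of the identity by a compact operator, which
    contradicts the Fredholm alternative. *)

From mathcomp Require Import all_boot all_order all_algebra complex.
From mathcomp Require Import all_classical all_reals all_analysis.
From mathcomp Require Import ring lra.
Require Import Defs.
Import numFieldNormedType.Exports.
Import Order.TTheory GRing.Theory Num.Theory.
Set Implicit Arguments. Unset Strict Implicit. Unset Printing Implicit Defensive.
Local Open Scope ring_scope.
Local Open Scope complex_scope.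
Local Open Scope classical_set_scope.

(** * Norm and inner product *)

(* A pairing of two orthonormal bases is at first defined only on finite combinations; a coercive
   relation with dense domain and range is enough, so no infinite sum and no extension by continuity
   is needed. Coercivity works because z orthogonal to t + s gives <t, t + s> = <t + z, t + s>, so
   that |t + z| controls |t|. The operator B enters because B^2 = 1 - A^2 commutes with both
   projections, hence so does |B|, and because B u = P_S u on T. The cut is a cut by angle: |t|^2 =
   |P_S t|^2 + |A t|^2 for t in T. On E the angles between T and S stay away from 0, so any
   isometric pairing keeps <t, s> uniformly above -|t|^2; on the complement of E they stay away from
   a right angle, so P_S is bounded below there. In the converse, compactness enters through Q P_S t
   - t = Q A t for t in T. Separability makes any two infinite dimensions equal, so unequal
   dimensions mean that the smaller one is finite. *)
Existing Class hilbert_inner.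

(** The norm of [V] takes values in [R[i]]; its real part gives access to real order and
    arithmetic. *)
Definition nrm (R : realType) (V : completeNormedModType R[i]) (x : V) : R :=
  complex.Re `|x|.

Definition reip (R : realType) (V : Type) (ip : V -> V -> R[i]) (x y : V) : R :=
  complex.Re (ip x y).

Section Basics.
Variables (R : realType) (V : completeNormedModType R[i]) (ip : V -> V -> R[i]).
Context {hip : hilbert_inner ip}.
Local Notation "<| x , y |>" := (reip ip x y).
Implicit Types x y z : V.

Lemma normE x : `|x| = (nrm x)%:C.
Proof. by rewrite /nrm RRe_real// ger0_real. Qed.

Lemma nrm_ge0 x : 0 <= nrm x.
Proof. by rewrite -ler0c -normE. Qed.

Lemma nrm0 : nrm (0 : V) = 0.
Proof. by rewrite /nrm normr0. Qed.

Lemma nrm_eq0 x : nrm x = 0 -> x = 0.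
Proof. by move=> h; apply/eqP; rewrite -normr_eq0 normE h. Qed.

Lemma nrmN x : nrm (- x) = nrm x.
Proof. by rewrite /nrm normrN. Qed.

Lemma nrmBC x y : nrm (x - y) = nrm (y - x).
Proof. by rewrite /nrm distrC. Qed.

Lemma nrmD x y : nrm (x + y) <= nrm x + nrm y.
Proof. by rewrite -lecR rmorphD/= -!normE ler_normD. Qed.

Lemma nrm_triB y x z : nrm (x - z) <= nrm (x - y) + nrm (y - z).
Proof. by apply: le_trans (nrmD _ _); rewrite addrA subrK. Qed.

Lemma nrmB x y : nrm (x - y) <= nrm x + nrm y.
Proof. by apply: le_trans (nrmD _ _) _; rewrite nrmN. Qed.

Lemma nrmZ (c : R[i]) x : nrm (c *: x) = complex.Re `|c| * nrm x.
Proof.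
by apply: complexI; rewrite -normE normrZ rmorphM/= RRe_real ?ger0_real// -normE.
Qed.

Lemma normcR (r : R) : `|r%:C| = `|r|%:C.
Proof. by rewrite normc_def/= expr0n/= addr0 sqrtr_sqr. Qed.

Lemma nrmZr (r : R) x : nrm (r%:C *: x) = `|r| * nrm x.
Proof. by rewrite nrmZ normcR. Qed.

Lemma ipDl x y z : ip (x + y) z = ip x z + ip y z.
Proof. by case: hip => h _ _; rewrite -{1}[x]scale1r h mul1r. Qed.

Lemma ip0l x : ip 0 x = 0.
Proof. by apply: (addIr (ip 0 x)); rewrite -ipDl addr0 add0r. Qed.

Lemma ipZl (c : R[i]) x y : ip (c *: x) y = c * ip x y.
Proof. by case: hip => h _ _; rewrite -{1}[c *: x]addr0 h ip0l addr0. Qed.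

Lemma ipC x y : ip y x = (ip x y)^*.
Proof. by case: hip. Qed.

Lemma ip0r x : ip x 0 = 0.
Proof. by rewrite ipC ip0l conjc0. Qed.

Lemma ipDr x y z : ip x (y + z) = ip x y + ip x z.
Proof. by rewrite ipC ipDl rmorphD/= -!ipC. Qed.

Lemma ipZr (c : R[i]) x y : ip x (c *: y) = c^* * ip x y.
Proof. by rewrite ipC ipZl rmorphM/= -ipC. Qed.

Lemma ipNl x y : ip (- x) y = - ip x y.
Proof. by rewrite -scaleN1r ipZl mulN1r. Qed.

Lemma ipNr x y : ip x (- y) = - ip x y.
Proof. by rewrite ipC ipNl rmorphN/= -ipC. Qed.

Lemma ipBl x y z : ip (x - y) z = ip x z - ip y z.
Proof. by rewrite ipDl ipNl. Qed.

Lemma ip_suml (I : Type) (r : seq I) (P : pred I) (F : I -> V) y :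
  ip (\sum_(i <- r | P i) F i) y = \sum_(i <- r | P i) ip (F i) y.
Proof. by apply: (big_morph (fun x => ip x y)) => [a b|]; rewrite ?ipDl ?ip0l. Qed.

Lemma ip_eq0C x y : ip x y = 0 -> ip y x = 0.
Proof. by move=> h; rewrite ipC h conjc0. Qed.

Lemma ipxx x : ip x x = (nrm x ^+ 2)%:C.
Proof. by case: hip => _ _ h; rewrite -h normE rmorphXn. Qed.

Lemma ReD (a b : R[i]) : complex.Re (a + b) = complex.Re a + complex.Re b.
Proof. by case: a; case: b. Qed.

Lemma ReN (a : R[i]) : complex.Re (- a) = - complex.Re a.
Proof. by case: a. Qed.

Lemma reipE x : <|x, x|> = nrm x ^+ 2.
Proof. by rewrite /reip ipxx. Qed.

Lemma reipC x y : <|x, y|> = <|y, x|>.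
Proof. by rewrite /reip (ipC y x); case: (ip y x). Qed.

Lemma reipDl x y z : <|x + y, z|> = <|x, z|> + <|y, z|>.
Proof. by rewrite /reip ipDl ReD. Qed.

Lemma reipDr x y z : <|x, y + z|> = <|x, y|> + <|x, z|>.
Proof. by rewrite /reip ipDr ReD. Qed.

Lemma reipNl x y : <|- x, y|> = - <|x, y|>.
Proof. by rewrite /reip ipNl ReN. Qed.

Lemma reipNr x y : <|x, - y|> = - <|x, y|>.
Proof. by rewrite /reip ipNr ReN. Qed.

Lemma reip0l x : <|0, x|> = 0.
Proof. by rewrite /reip ip0l. Qed.

Lemma reip0r x : <|x, 0|> = 0.
Proof. by rewrite /reip ip0r. Qed.

Lemma reipZl (r : R) x y : <|r%:C *: x, y|> = r * <|x, y|>.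
Proof. by rewrite /reip ipZl; case: (ip x y) => a b /=; rewrite mul0r subr0. Qed.

Lemma reipZr (r : R) x y : <|x, r%:C *: y|> = r * <|x, y|>.
Proof. by rewrite reipC reipZl reipC. Qed.

Definition reipD := (reipDl, reipDr, reipNl, reipNr, reipZl, reipZr).

(** The scalars [1] and [i] recover the real and imaginary parts of [ip x y], so orthogonality can
    be tested with the real form alone. *)
Lemma ip0P x y : (forall c : R[i], <|x, c *: y|> = 0) -> ip x y = 0.
Proof.
move=> h; have := h 1; have := h 'i%C; rewrite /reip !ipZr.
case: (ip x y) => a b /=; rewrite !mul0r !mulN1r opprK add0r => -> /=.
by rewrite !mulr0 mul1r subr0 => ->.
Qed.

Lemma reip0 x y : ip x y = 0 -> <|x, y|> = 0.
Proof. by rewrite /reip => ->. Qed.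

Lemma nrmD2 x y : nrm (x + y) ^+ 2 = nrm x ^+ 2 + 2 * <|x, y|> + nrm y ^+ 2.
Proof. by rewrite -!reipE !reipD (reipC y x); ring. Qed.

Lemma nrmB2 x y : nrm (x - y) ^+ 2 = nrm x ^+ 2 - 2 * <|x, y|> + nrm y ^+ 2.
Proof. by rewrite nrmD2 nrmN reipNr; ring. Qed.

(** The square of the norm of [|y| x - |x| y] expands to [2 |x| |y| (|x| |y| - <x, y>)]. *)
Lemma cauchy_schwarz x y : <|x, y|> <= nrm x * nrm y.
Proof.
have [y0|y0] := eqVneq (nrm y) 0; first by rewrite (nrm_eq0 y0) reip0r nrm0 mulr0.
have yp : 0 < nrm y by rewrite lt_neqAle eq_sym y0 nrm_ge0.
have [x0|x0] := eqVneq (nrm x) 0; first by rewrite (nrm_eq0 x0) reip0l nrm0 mul0r.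
have xp : 0 < nrm x by rewrite lt_neqAle eq_sym x0 nrm_ge0.
have := sqr_ge0 (nrm ((nrm y)%:C *: x - (nrm x)%:C *: y)).
rewrite nrmB2 !nrmZr !reipD !ger0_norm ?nrm_ge0// => h.
have : 0 <= 2 * (nrm x * nrm y) * (nrm x * nrm y - <|x, y|>).
  by apply: le_trans h _; rewrite le_eqVlt; apply/orP; left; apply/eqP; ring.
by rewrite pmulr_rge0 ?subr_ge0// !mulr_gt0.
Qed.

Lemma abs_cauchy_schwarz x y : `|<|x, y|>| <= nrm x * nrm y.
Proof.
rewrite ler_norml cauchy_schwarz andbT lerNl -reipNl -(nrmN x).
exact: cauchy_schwarz.
Qed.

Lemma nrm_le_sqr x (a : R) : 0 <= a -> nrm x ^+ 2 <= a ^+ 2 -> nrm x <= a.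
Proof. by move=> a0; rewrite ler_sqr ?nnegrE ?nrm_ge0. Qed.

(** * Convergence, closure and completeness with real radii *)

Definition cvs (u : nat -> V) (l : V) :=
  forall e : R, 0 < e -> exists N, forall n, (N <= n)%N -> nrm (u n - l) < e.

Definition adh (M : set V) (x : V) :=
  forall e : R, 0 < e -> exists2 y, M y & nrm (x - y) < e.

Lemma posC (e : R[i]) : 0 < e -> exists2 r : R, 0 < r & e = r%:C.
Proof.
move=> e0; exists (complex.Re e); last by rewrite RRe_real// gtr0_real.
by move: e0; rewrite ltcE => /andP[].
Qed.

Lemma ballnrm x y (r : R) : ball x r%:C y <-> nrm (x - y) < r.
Proof. by rewrite -ball_normE /ball_/= normE ltcR. Qed.

Lemma closureE_adh (M : set V) x : closure M x <-> adh M x.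
Proof.
split=> [h e e0|h B].
  have /h[y [My /ballnrm ?]] : nbhs x (ball x e%:C).
    by apply: nbhsx_ballx; rewrite ltcR.
  by exists y.
move=> /nbhs_ballP[e /= /posC[r r0 ->]] xB.
by have [y My xy] := h r r0; exists y; split=> //; apply/xB/ballnrm.
Qed.

Lemma closedP (M : set V) : closed M <-> (forall x, adh M x -> M x).
Proof.
split=> h x; first by move=> /closureE_adh; exact: h.
by move=> /closureE_adh; exact: h.
Qed.

Lemma adh_cvs (M : set V) (u : nat -> V) l :
  (forall n, M (u n)) -> cvs u l -> adh M l.
Proof.
move=> Mu ul e e0; have [N hN] := ul _ e0.
by exists (u N) => //; rewrite nrmBC; exact: hN.
Qed.

Lemma complete_seq (u : nat -> V) :
  (forall e : R, 0 < e -> exists N, forall m n, (N <= m)%N -> (N <= n)%N ->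
     nrm (u m - u n) < e) -> exists l, cvs u l.
Proof.
move=> cu; have /cauchy_cvgP cvu : cauchy (u @ \oo).
  apply/cauchy_exP => e /posC[r r0 ->]; have [N hN] := cu _ r0.
  exists (u N); exists N => // n /= Nn; apply/ballnrm; exact: hN.
exists (lim (u @ \oo)) => e e0.
have /cvgrPdist_lt/(_ e%:C) := cvu; rewrite ltcR => /(_ e0)[N _ hN].
by exists N => n Nn; rewrite nrmBC -ltcR -normE; exact: hN.
Qed.

End Basics.

(** * Closed subspaces and orthogonal projections *)

Section Subspaces.
Variables (R : realType) (V : completeNormedModType R[i]) (ip : V -> V -> R[i]).
Context {hip : hilbert_inner ip}.
Local Notation "<| x , y |>" := (reip ip x y).
Implicit Types (x y z : V) (M T : set V).

Definition lin (L : V -> V) := forall (a : R[i]) x y, L (a *: x + y) = a *: L x + L y.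

Lemma linD (L : V -> V) x y : lin L -> L (x + y) = L x + L y.
Proof. by move=> h; rewrite -[in LHS](scale1r x) h scale1r. Qed.

Lemma lin0 (L : V -> V) : lin L -> L 0 = 0.
Proof. by move=> h; apply: (addIr (L 0)); rewrite -linD// addr0 add0r. Qed.

Lemma linZ (L : V -> V) a x : lin L -> L (a *: x) = a *: L x.
Proof. by move=> h; rewrite -[in LHS](addr0 (a *: x)) h lin0// addr0. Qed.

Lemma linN (L : V -> V) x : lin L -> L (- x) = - L x.
Proof. by move=> h; rewrite -scaleN1r linZ// scaleN1r. Qed.

Lemma linB (L : V -> V) x y : lin L -> L (x - y) = L x - L y.
Proof. by move=> h; rewrite linD// linN. Qed.

Lemma lin_sum (L : V -> V) (I : Type) (r : seq I) (F : I -> V) : lin L ->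
  L (\sum_(i <- r) F i) = \sum_(i <- r) L (F i).
Proof. by move=> h; apply: (big_morph L) => [a b|]; rewrite ?linD ?lin0. Qed.

Lemma subZD M a x y : subspace M -> M x -> M y -> M (a *: x + y).
Proof. by case=> _; apply. Qed.

Lemma subZ M a x : subspace M -> M x -> M (a *: x).
Proof. by move=> [M0 h] Mx; rewrite -[_ *: _]addr0; apply: h. Qed.

Lemma subD M x y : subspace M -> M x -> M y -> M (x + y).
Proof. by move=> [M0 h] Mx My; rewrite -[x]scale1r; apply: h. Qed.

Lemma subN M x : subspace M -> M x -> M (- x).
Proof. by move=> hM Mx; rewrite -scaleN1r; apply: subZ. Qed.

Lemma subB M x y : subspace M -> M x -> M y -> M (x - y).
Proof. by move=> hM Mx My; apply: subD => //; apply: subN. Qed.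

Lemma sub_sum M (I : Type) (r : seq I) (F : I -> V) :
  subspace M -> (forall i, M (F i)) -> M (\sum_(i <- r) F i).
Proof.
move=> hM MF; elim/big_ind: _ => //; first by case: hM.
by move=> x y; apply: subD.
Qed.

Lemma orthP M x : subspace M -> (forall y, M y -> <|x, y|> = 0) -> orth ip M x.
Proof. by move=> hM h y My; apply: ip0P => c; apply: h; apply: subZ. Qed.

Lemma orth_subspace M : subspace (orth ip M).
Proof.
split=> [y _|a x y hx hy z Mz]; first exact: ip0l.
by rewrite ipDl ipZl hx// hy// mulr0 addr0.
Qed.

Lemma adh_reip0 M x z : (forall y, M y -> <|y, z|> = 0) -> adh M x -> <|x, z|> = 0.
Proof.
move=> h ax; apply/eqP; rewrite -normr_le0; apply/ler_addgt0Pl => e e0.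
rewrite addr0; have zp : 0 < nrm z + 1 by rewrite ltr_wpDl ?nrm_ge0.
have [y My hy] := ax (e / (nrm z + 1)) (divr_gt0 e0 zp).
have -> : <|x, z|> = <|x - y, z|> by rewrite !reipD (h y)// subr0.
apply: le_trans (abs_cauchy_schwarz _ _) _.
apply: le_trans (ler_wpM2r (nrm_ge0 z) (ltW hy)) _.
by rewrite -mulrA ler_piMr ?(ltW e0)// ler_pdivrMl// mulr1 ler_wpDr.
Qed.

Lemma adh_ip0 M x z : (forall y, M y -> ip y z = 0) -> adh M x -> ip x z = 0.
Proof.
move=> h ax; apply: ip0P => c; apply: (adh_reip0 _ ax) => y My.
by rewrite /reip ipZr h// mulr0.
Qed.

Lemma orth_closed M : closed (orth ip M).
Proof. by apply/closedP => x ax y My; apply: (adh_ip0 _ ax) => z; apply. Qed.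

Lemma orth_closed_subspace M : closed_subspace (orth ip M).
Proof. by split; [exact: orth_subspace|exact: orth_closed]. Qed.

Lemma adhW M x : M x -> adh M x.
Proof. by move=> Mx e e0; exists x => //; rewrite subrr nrm0. Qed.

Lemma adh_subspace M : subspace M -> subspace (adh M).
Proof.
move=> hM; split=> [|a x y ax ay e e0]; first by apply: adhW; case: hM.
have cp : 0 < complex.Re `|a| + 1.
  by rewrite ltr_wpDl// -ler0c RRe_real ?ger0_real.
have e2 : 0 < e / 2 by rewrite divr_gt0.
have [x' Mx hx] := ax (e / 2 / (complex.Re `|a| + 1)) (divr_gt0 e2 cp).
have [y' My hy] := ay _ e2.
exists (a *: x' + y'); first exact: subZD.
have -> : a *: x + y - (a *: x' + y') = a *: (x - x') + (y - y').
  by rewrite scalerBr addrACA opprD.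
apply: le_lt_trans (nrmD _ _) _; rewrite nrmZ [e in _ < e]splitr.
apply: ler_ltD => //; move: hx; rewrite ltr_pdivlMr// => hx.
apply: le_trans (ltW hx); rewrite mulrC ler_wpM2l ?nrm_ge0//.
by rewrite lerDl.
Qed.

Lemma adh_closed M : closed (adh M).
Proof.
apply/closedP => x ax e e0; have e2 : 0 < e / 2 by rewrite divr_gt0.
have [y ay hy] := ax _ e2; have [z Mz hz] := ay _ e2.
exists z => //; apply: le_lt_trans (nrm_triB y _ _) _.
by rewrite [e]splitr ltrD.
Qed.

Lemma cvs_adh_le (u : nat -> V) l x (B : R) N :
  cvs u l -> (forall n, (N <= n)%N -> nrm (u n - x) <= B) -> nrm (l - x) <= B.
Proof.
move=> ul h; apply/ler_addgt0Pl => e e0.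
have [K hK] := ul _ e0; apply: le_trans (nrm_triB (u (maxn K N)) _ _) _.
by apply: lerD; [rewrite nrmBC ltW// hK// leq_maxl|rewrite h// leq_maxr].
Qed.

(** The increments of [u] are dominated by those of a nondecreasing bounded real sequence, which is
    Cauchy because it approaches its supremum. *)
Lemma cauchy_tele (u : nat -> V) (b : nat -> R) (B : R) :
  (forall n, b n <= B) -> (forall n, nrm (u n.+1 - u n) <= b n.+1 - b n) ->
  exists2 l, cvs u l & forall n, nrm (u n - l) <= B - b n.
Proof.
move=> bB ub.
have ubk n k : nrm (u (n + k)%N - u n) <= b (n + k)%N - b n.
  elim: k => [|k IH]; first by rewrite addn0 !subrr nrm0.
  rewrite addnS; apply: le_trans (nrm_triB (u (n + k)%N) _ _) _.
  apply: le_trans (lerD (ub _) IH) _; lra.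
have bm n k : b n <= b (n + k)%N.
  by rewrite -subr_ge0; apply: le_trans (ubk n k); rewrite nrm_ge0.
have hs : has_sup (range b).
  by split; [exists (b 0%N), 0%N|exists B => _ [n _ <-]].
have [l ul] : exists l, cvs u l.
  apply: complete_seq => e e0.
  have e2 : 0 < e / 2 by rewrite divr_gt0.
  have [_ [N _ <-] hN] := sup_adherent e2 hs.
  have key n : (N <= n)%N -> nrm (u n - u N) < e / 2.
    move=> /subnKC <-; apply: le_lt_trans (ubk _ _) _.
    have : b (N + (n - N))%N <= sup (range b).
      by apply: ub_le_sup; [case: hs|exists (N + (n - N))%N].
    by move: hN; lra.
  exists N => m n Nm Nn; apply: le_lt_trans (nrm_triB (u N) _ _) _.
  by rewrite [e]splitr; apply: ltrD; [|rewrite nrmBC]; apply: key.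
exists l => // n; rewrite nrmBC; apply: (cvs_adh_le (N := n) ul) => m.
move=> /subnKC <-; apply: le_trans (ubk _ _) _.
by have := bB (n + (m - n))%N; lra.
Qed.

Lemma small_inv (e : R) : 0 < e -> exists n : nat, n.+1%:R^-1 < e.
Proof.
move=> e0; exists (Num.truncn e^-1); rewrite invf_plt ?posrE//.
exact: truncnS_gt.
Qed.

(** A sequence in [M] that minimizes the distance to [x] is Cauchy by the parallelogram law; its
    limit is the foot of the perpendicular. *)
Lemma projection_ex M x : closed_subspace M -> exists2 y, M y & orth ip M (x - y).
Proof.
move=> [hM /closedP cM].
pose D := [set nrm (x - m) | m in M]; have M0 : M 0 by case: hM.
have hD : has_inf D.
  by split; [exists (nrm (x - 0)), 0|exists 0 => _ [m _ <-]; exact: nrm_ge0].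
pose d := inf D; have dle m : M m -> d <= nrm (x - m).
  by move=> Mm; apply: ge_inf; [case: hD|exists m].
have d0 : 0 <= d by apply: lb_le_inf; [case: hD|move=> _ [m _ <-]; exact: nrm_ge0].
have yex (n : nat) : exists m, M m /\ nrm (x - m) < d + n.+1%:R^-1.
  have n0 : 0 < n.+1%:R^-1 :> R by rewrite invr_gt0.
  by have [_ [m Mm <-] h] := inf_adherent n0 hD; exists m.
have [y hy] := choice yex.
(* Parallelogram law with the midpoint of [a] and [b], itself at distance at least [d]: the bound is
   [4 (d + r)^2 - 4 d^2]. *)
have par (a b : V) (r : R) : M a -> M b -> nrm (x - a) < d + r -> nrm (x - b) < d + r ->
    nrm (a - b) ^+ 2 <= 8 * d * r + 4 * r ^+ 2.
  move=> Ma Mb ha hb.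
  have /dle hm : M ((2^-1)%:C *: (a + b)) by apply: subZ => //; apply: subD.
  have e1 : nrm (a - b) ^+ 2 = 2 * nrm (x - a) ^+ 2 + 2 * nrm (x - b) ^+ 2
      - 4 * nrm (x - (2^-1)%:C *: (a + b)) ^+ 2.
    rewrite !nrmB2 nrmZr reipZr reipDr ger0_norm ?invr_ge0// exprMn nrmD2.
    by field.
  rewrite e1; have := nrm_ge0 (x - a); have := nrm_ge0 (x - b).
  set A := nrm (x - a) in ha *; set B := nrm (x - b) in hb *.
  set C := nrm _ in hm *; move=> B0 A0.
  have hA : A ^+ 2 <= (d + r) ^+ 2 by rewrite ler_sqr ?nnegrE; lra.
  have hB : B ^+ 2 <= (d + r) ^+ 2 by rewrite ler_sqr ?nnegrE; lra.
  have hC : d ^+ 2 <= C ^+ 2 by rewrite ler_sqr ?nnegrE; lra.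
  by nra.
have near_d (r : R) : 0 < r -> exists N, forall n, (N <= n)%N -> nrm (x - y n) < d + r.
  move=> r0; have [N hN] := small_inv r0; exists N => n Nn.
  apply: lt_trans (proj2 (hy n)) _; rewrite ltrD2l; apply: le_lt_trans hN.
  by rewrite lef_pV2 ?posrE// ler_nat.
have [l yl] : exists l, cvs y l.
  apply: complete_seq => e e0.
  (* For [r <= 1] the bound of [par] is at most [(8 d + 4) r], which is less than
     [(8 d + 5) r <= e^2]. *)
  pose r := Num.min 1 (e ^+ 2 / (8 * d + 5)).
  have dp : 0 < 8 * d + 5 by lra.
  have r0 : 0 < r by rewrite lt_min ltr01/= divr_gt0// exprn_gt0.
  have r1 : r <= 1 by rewrite ge_min lexx.
  have r2 : r * (8 * d + 5) <= e ^+ 2 by rewrite -ler_pdivlMr// ge_min lexx orbT.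
  have [N hN] := near_d _ r0; exists N => m n Nm Nn.
  have := par _ _ _ (proj1 (hy m)) (proj1 (hy n)) (hN m Nm) (hN n Nn) => h.
  have : nrm (y m - y n) ^+ 2 < e ^+ 2 by apply: le_lt_trans h _; nra.
  by rewrite ltr_sqr ?nnegrE ?nrm_ge0 ?ltW.
have Ml : M l by apply: cM; apply: (adh_cvs _ yl) => n; case: (hy n).
have xl : nrm (x - l) <= d.
  apply/ler_addgt0Pl => r r0; have [N hN] := near_d _ r0.
  rewrite nrmBC; apply: (cvs_adh_le (N := N) yl) => n Nn.
  by rewrite nrmBC [r + d]addrC; apply: ltW; apply: hN.
exists l => //; apply: orthP => // m Mm.
(* Moving [l] by [r m] cannot shorten the distance, so [2 r a <= r^2 q]; with [a = r (q + 1)] this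
   forces [r = 0]. The [+ 1] keeps the denominator positive when [m = 0]. *)
pose a := <|x - l, m|>; pose q := nrm m ^+ 2; pose r := a / (q + 1).
have q0 : 0 <= q by rewrite sqr_ge0.
have /dle h : M (l + r%:C *: m) by apply: subD => //; apply: subZ.
have {}h : nrm (x - l) ^+ 2 <= nrm (x - l - r%:C *: m) ^+ 2.
  rewrite ler_sqr ?nnegrE ?nrm_ge0//; apply: le_trans xl _.
  by rewrite -addrA -opprD.
move: h; rewrite (nrmB2 (x - l)) reipZr nrmZr exprMn -normrX ger0_norm ?sqr_ge0// -/a -/q => h.
have ra : a = r * (q + 1) by rewrite /r divfK//; lra.
have : r ^+ 2 <= 0 by nra.
by rewrite -/a ra => r2; have /eqP := le_anti (introT andP (conj r2 (sqr_ge0 r)));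
  rewrite sqrf_eq0 => /eqP ->; rewrite mul0r.
Qed.

Lemma proj_ex M : closed_subspace M -> exists P, is_orth_proj ip M P.
Proof.
move=> hM; have h x : exists y, M y /\ orth ip M (x - y).
  by have [y] := projection_ex x hM; exists y.
by have [P hP] := choice h; exists P.
Qed.

Lemma orth_self0 M x : M x -> orth ip M x -> x = 0.
Proof.
move=> Mx /(_ x Mx); rewrite ipxx => -[] /eqP; rewrite sqrf_eq0 => /eqP.
exact: nrm_eq0.
Qed.

Lemma orth_orth M x : closed_subspace M -> orth ip (orth ip M) x -> M x.
Proof.
move=> hM ox; have [y My oxy] := projection_ex x hM.
have -> // : x = y; apply/eqP; rewrite -subr_eq0; apply/eqP.
apply: (@orth_self0 (orth ip M)) => //.
apply: (@subB (orth ip (orth ip M))) => //; first exact: orth_subspace.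
by move=> z oz; apply: ip_eq0C; exact: oz.
Qed.

(** The difference between [x] and its projection on the closure of [D] is still in [T] and is
    orthogonal to [D]. *)
Lemma dense_adh D T x : subspace D -> subspace T -> D `<=` T -> closed T ->
  (forall y, T y -> orth ip D y -> y = 0) -> T x -> adh D x.
Proof.
move=> hD hT DT cT h Tx.
have hA : closed_subspace (adh D) by split; [exact: adh_subspace|exact: adh_closed].
have [y ay oy] := projection_ex x hA.
have Ty : T y.
  by move/closedP : cT; apply=> e e0; have [z Dz zy] := ay e e0; exists z => //; exact: DT.
have /eqP : x - y = 0.
  by apply: h; [exact: subB|move=> z Dz; apply: oy; exact: adhW].
by rewrite subr_eq0 => /eqP ->.
Qed.

End Subspaces.

(** * Calculus of projections, closed images, uniform boundedness *)

Section Projections.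
Variables (R : realType) (V : completeNormedModType R[i]) (ip : V -> V -> R[i]).
Context {hip : hilbert_inner ip}.
Local Notation "<| x , y |>" := (reip ip x y).
Implicit Types (x y z : V) (M T Z : set V).

Section OneProjection.
Variables (M : set V) (P : V -> V).
Hypotheses (hM : subspace M) (hP : is_orth_proj ip M P).

Lemma proj_in x : M (P x).
Proof. by case: (hP x). Qed.

Lemma proj_uniq x y : M y -> orth ip M (x - y) -> P x = y.
Proof.
move=> My oxy; apply/eqP; rewrite -subr_eq0; apply/eqP.
apply: (@orth_self0 _ _ ip _ M); first by apply: subB => //; exact: proj_in.
have -> : P x - y = (x - y) - (x - P x) by rewrite opprB [RHS]addrC addrA subrK.
by apply: (@subB _ _ (orth ip M)) => //; [exact: orth_subspace|case: (hP x)].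
Qed.

Lemma proj_id x : M x -> P x = x.
Proof. by move=> Mx; apply: proj_uniq => //; rewrite subrr; case: (orth_subspace M). Qed.

Lemma proj_orth0 x : orth ip M x -> P x = 0.
Proof. by move=> ox; apply: proj_uniq; [case: hM|rewrite subr0]. Qed.

Lemma proj_lin : lin P.
Proof.
move=> a x y; apply: proj_uniq; first by apply: subZD => //; exact: proj_in.
have -> : a *: x + y - (a *: P x + P y) = a *: (x - P x) + (y - P y).
  by rewrite scalerBr addrACA opprD.
by apply: (@subZD _ _ (orth ip M)) => //; [exact: orth_subspace|case: (hP x)|case: (hP y)].
Qed.

Lemma ip_proj x y : M y -> ip (P x) y = ip x y.
Proof.
move=> My; apply/esym/eqP; rewrite -subr_eq0 -ipBl; apply/eqP.
exact: (proj2 (hP x)).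
Qed.

Lemma proj_sa x y : ip (P x) y = ip x (P y).
Proof. by rewrite -(ip_proj x (proj_in y)) ipC -(ip_proj y (proj_in x)) -ipC. Qed.

Lemma reip_proj x y : M y -> <|P x, y|> = <|x, y|>.
Proof. by move=> My; rewrite /reip ip_proj. Qed.

Lemma proj_rsa x y : <|P x, y|> = <|x, P y|>.
Proof. by rewrite /reip proj_sa. Qed.

Lemma proj_pyth x : nrm x ^+ 2 = nrm (P x) ^+ 2 + nrm (x - P x) ^+ 2.
Proof.
by rewrite nrmB2 -(reip_proj x (proj_in x)) reipE; ring.
Qed.

Lemma proj_le x : nrm (P x) <= nrm x.
Proof. by apply: nrm_le_sqr; rewrite ?nrm_ge0// (proj_pyth x) lerDl sqr_ge0. Qed.

Lemma reip_proj_self x : <|P x, x|> = nrm (P x) ^+ 2.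
Proof. by rewrite reipC -(reip_proj x (proj_in x)) reipE. Qed.

Lemma proj_eq0 x : P x = 0 -> orth ip M x.
Proof. by move=> Px; have := proj2 (hP x); rewrite Px subr0. Qed.

End OneProjection.

(** The lower bound turns a convergent sequence of images into a Cauchy sequence of preimages. *)
Lemma image_closed T (L : V -> V) (c C : R) : closed_subspace T -> lin L -> 0 < c ->
  (forall x, nrm (L x) <= C * nrm x) -> (forall t, T t -> c * nrm t <= nrm (L t)) ->
  closed_subspace (L @` T).
Proof.
move=> [hT /closedP cT] hL c0 LC Lc; split.
  split=> [|a _ _ [x Tx <-] [y Ty <-]]; first by exists 0; [case: hT|exact: lin0].
  by exists (a *: x + y); [exact: subZD|exact: hL].
apply/closedP => y ay.
have uex (n : nat) : exists t, T t /\ nrm (y - L t) < n.+1%:R^-1.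
  have n0 : 0 < n.+1%:R^-1 :> R by rewrite invr_gt0.
  by have [_ [t Tt <-] h] := ay _ n0; exists t.
have [u hu] := choice uex.
have near0 (r : R) : 0 < r -> exists N, forall n, (N <= n)%N -> nrm (y - L (u n)) < r.
  move=> r0; have [N hN] := small_inv r0; exists N => n Nn.
  apply: lt_trans (proj2 (hu n)) _; apply: le_lt_trans hN.
  by rewrite lef_pV2 ?posrE// ler_nat.
have [l ul] : exists l, cvs u l.
  apply: complete_seq => e e0.
  have e2 : 0 < c * e / 2 by rewrite divr_gt0// mulr_gt0.
  have [N hN] := near0 _ e2; exists N => m n Nm Nn.
  rewrite -(ltr_pM2l c0); apply: le_lt_trans (Lc _ _) _.
    by apply: subB => //; [case: (hu m)|case: (hu n)].
  rewrite linB//; apply: le_lt_trans (nrm_triB y _ _) _.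
  by rewrite [c * e]splitr; apply: ltrD; [rewrite nrmBC|]; apply: hN.
exists l; first by apply: cT; apply: (adh_cvs _ ul) => n; case: (hu n).
apply/eqP; rewrite -subr_eq0; apply/eqP/nrm_eq0/le_anti; rewrite nrm_ge0 andbT.
apply/ler_addgt0Pl => e e0; rewrite addr0.
have e2 : 0 < e / 2 by rewrite divr_gt0.
have Cp : 0 < `|C| + 1 by rewrite ltr_wpDl.
have [N hN] := near0 _ e2; have [K hK] := ul _ (divr_gt0 e2 Cp).
pose n := maxn N K; apply: le_trans (nrm_triB (L (u n)) _ _) _.
rewrite [e]splitr; apply: lerD; last by rewrite nrmBC; apply/ltW/hN/leq_maxl.
rewrite -linB//; apply: le_trans (LC _) _; rewrite nrmBC.
have {}hK := hK n (leq_maxr _ _); rewrite ltr_pdivlMr// in hK.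
apply: le_trans (ltW hK); rewrite mulrC ler_wpM2l ?nrm_ge0//.
by apply: le_trans (ler_norm _) _; rewrite lerDl.
Qed.

(** Uniform boundedness by a gliding hump: vectors [y n] of very large norm are added with weights
    [3^-(n+1)], and the limit pairs with [y n] beyond any bound. *)
Lemma weakly_bounded (F : set V) :
  (forall x, exists B, forall y, F y -> <|y, x|> <= B) ->
  exists B, forall y, F y -> nrm y <= B.
Proof.
move=> hF; apply: contrapT => nb.
have yex (n : nat) : exists y, F y /\ 2 * n.+1%:R * 3 ^+ n.+1 < nrm y.
  apply: contrapT => h; apply: nb; exists (2 * n.+1%:R * 3 ^+ n.+1) => y Fy.
  by rewrite leNgt; apply/negP => yn; apply: h; exists y.
have [y hy] := choice yex.
have yp n : 0 < nrm (y n).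
  by apply: le_lt_trans (proj2 (hy n)); rewrite mulr_ge0// exprn_ge0.
pose q n : R := 3^-1 ^+ n; have q0 n : 0 < q n by rewrite exprn_gt0// invr_gt0.
(* The sign keeps the new term from cancelling [<y n, x>], which yields [big] below. *)
pose s n x : R := if 0 <= <|y n, x|> then 1 else -1.
have s1 n x : `|s n x| = 1 by rewrite /s; case: ifP; rewrite ?normrN normr1.
pose step n x := x + (s n x * q n.+1 / nrm (y n))%:C *: y n.
pose xs := fix xs n := if n is m.+1 then step m (xs m) else 0.
have d n : nrm (xs n.+1 - xs n) = q n.+1.
  rewrite /= /step addrC addKr nrmZr !normrM s1 mul1r normfV.
  by rewrite (gtr0_norm (q0 _)) (gtr0_norm (yp n)) divfK// gt_eqF.
have big n : q n.+1 * nrm (y n) <= `|<|y n, xs n.+1|>|.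
  rewrite /= /step reipDr reipZr reipE expr2 mulrA divfK ?gt_eqF//.
  rewrite /s; set a := <|_, _|>; set b := nrm _; case: ifP => [|/negbT] h.
    by apply: le_trans (ler_norm _); lra.
  rewrite -ltNge in h; rewrite -normrN; apply: le_trans (ler_norm _); lra.
have qS n : q n.+1 = q n / 3 by rewrite /q exprSr.
(* [q n / 2] is the total length of the steps from [xs n] on, so after [xs n.+1] the tail destroys
   at most half of the pairing found in [big]. *)
have [| |l ul hl] := @cauchy_tele _ _ xs (fun n => - q n / 2) 0.
- by move=> n; rewrite mulNr oppr_le0 divr_ge0// ltW.
- by move=> n; rewrite d qS; lra.
(* The bounds are one-sided, so both [l] and [- l] are used. What survives of the pairing exceeds
   [n + 1], while [n + 1 > B]. *)
have [B1 hB1] := hF l; have [B2 hB2] := hF (- l).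
pose B := Num.max B1 B2; pose n := Num.truncn B.
have nB : B < n.+1%:R by exact: truncnS_gt.
have yl : `|<|y n, l|>| <= B.
  rewrite ler_norml le_max (hB1 _ (proj1 (hy n))) andbT lerNl -reipNr.
  by rewrite le_max (hB2 _ (proj1 (hy n))) orbT.
have hd : `|<|y n, xs n.+1|>| <= `|<|y n, l|>| + nrm (y n) * (q n.+1 / 2).
  have -> : <|y n, xs n.+1|> = <|y n, l|> + <|y n, xs n.+1 - l|>.
    by rewrite -reipDr addrC subrK.
  apply: le_trans (ler_normD _ _) _; rewrite lerD2l.
  apply: le_trans (abs_cauchy_schwarz _ _) _; rewrite ler_wpM2l ?nrm_ge0//.
  by apply: le_trans (hl _) _; rewrite mulNr sub0r opprK.
have hq : q n.+1 * 3 ^+ n.+1 = 1 by rewrite /q -exprMn mulVf// expr1n.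
have : q n.+1 * (2 * n.+1%:R * 3 ^+ n.+1) < q n.+1 * nrm (y n).
  by rewrite ltr_pM2l//; case: (hy n).
rewrite mulrCA hq mulr1; have := big n; lra.
Qed.

(* The family of y in Z^⊥ with |P_T y| <= 1 is weakly bounded, hence P_T is
   bounded below on Z^⊥, and its image there is all of T. *)
Lemma complement_bounded T Z : closed_subspace T -> closed_subspace Z ->
  T `&` Z = [set 0] -> (forall x, exists t z, [/\ T t, Z z & x = t + z]) ->
  exists2 C : R, 0 < C & forall t z, T t -> Z z -> nrm t <= C * nrm (t + z).
Proof.
move=> hT hZ TZ0 TZ; have [P hP] := proj_ex hT; have hT' := hT.1.
have linP := proj_lin hT' hP.
have [|B hB] := @weakly_bounded [set y | orth ip Z y /\ nrm (P y) <= 1].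
  move=> x; have [t [z [Tt Zz ->]]] := TZ x; exists (nrm t) => y [oy yP].
  rewrite reipDr (reip0 (oy z Zz)) addr0 -(reip_proj hP _ Tt).
  apply: le_trans (cauchy_schwarz _ _) _.
  by rewrite ler_piMl ?nrm_ge0.
pose C := Num.max B 1; have C0 : 0 < C by rewrite lt_max ltr01 orbT.
have hC y : orth ip Z y -> nrm y <= C * nrm (P y).
  (* If [P y = 0], every multiple of [y] belongs to the bounded family, so [y] vanishes; otherwise
     [y] is scaled to [nrm (P y) = 1]. *)
  move=> oy; have [p0|p0] := eqVneq (nrm (P y)) 0.
    rewrite p0 mulr0; have scal (r : R) : 0 < r -> r * nrm y <= B.
      move=> r0; rewrite -[X in X * _](gtr0_norm r0) -nrmZr; apply: hB; split.
        by apply: (@subZ _ _ (orth ip Z)) => //; exact: orth_subspace.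
      by rewrite linZ// nrmZr p0 mulr0.
    rewrite leNgt; apply/negP => yp.
    have := scal ((`|B| + 1) / nrm y); rewrite divfK ?gt_eqF// divr_gt0 ?ltr_wpDl//.
    by move=> /(_ isT); have := ler_norm B; lra.
  have pp : 0 < nrm (P y) by rewrite lt_neqAle eq_sym p0 nrm_ge0.
  have : nrm (((nrm (P y))^-1)%:C *: y) <= B.
    apply: hB; split; first by apply: (@subZ _ _ (orth ip Z)) => //; exact: orth_subspace.
    by rewrite linZ// nrmZr normfV gtr0_norm// mulVf.
  rewrite nrmZr normfV gtr0_norm// ler_pdivrMl// mulrC => h.
  by apply: le_trans h _; rewrite ler_wpM2r ?nrm_ge0// le_max lexx.
have cI : closed_subspace (P @` orth ip Z).
  apply: (image_closed (c := C^-1) (C := 1)) => //; [exact: orth_closed_subspace|by rewrite invr_gt0|..].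
    by move=> x; rewrite mul1r; exact: (proj_le hP).
  by move=> y oy; rewrite ler_pdivrMl//; exact: hC.
exists C => // t z Tt Zz.
(* What is left of [t] after projecting on the closed image is in [T] and orthogonal to the image,
   hence in the double orthocomplement [Z], hence zero. *)
have [y oy yt] : (P @` orth ip Z) t.
  have [_ [y oy <-] ot] := projection_ex t cI.
  exists y => //; apply/esym/eqP; rewrite -subr_eq0; apply/eqP.
  have Tty : T (t - P y) by apply: subB => //; exact: (proj_in hP).
  have Zty : Z (t - P y).
    apply: (orth_orth hZ) => w ow.
    by rewrite ipC -(ip_proj hP w Tty) -ipC; apply: ot; exists w.
  by have : (T `&` Z) (t - P y) by []; rewrite TZ0.
have [t0|t0] := eqVneq (nrm t) 0; first by rewrite t0 mulr_ge0 ?nrm_ge0// ltW.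
have tp : 0 < nrm t by rewrite lt_neqAle eq_sym t0 nrm_ge0.
(* With [t = P y]: [|t|^2 = <y, t> = <y, t + z> <= C |t| |t + z|]. *)
rewrite -(ler_pM2r tp) -expr2 -reipE -[in X in <|X, _|>]yt (reip_proj hP y Tt) reipC.
have -> : <|t, y|> = <|t + z, y|>.
  by rewrite reipDl [<|z, y|>]reipC (reip0 (oy z Zz)) addr0.
apply: le_trans (cauchy_schwarz _ _) _; rewrite (mulrC C) -mulrA.
rewrite ler_wpM2l ?nrm_ge0//; apply: le_trans (hC _ oy) _.
by rewrite yt.
Qed.

End Projections.

(** * Totally bounded sets *)

Section TotallyBounded.
Variables (R : realType) (V : completeNormedModType R[i]).
Implicit Types (x y z : V) (X Y : set V).

(** By completeness this is compactness of the closure, in a form stable under sums, Lipschitz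
    images and uniform approximation. *)
Definition totally_bounded X := forall e : R, 0 < e ->
  exists s : seq V, forall x, X x -> exists2 y, y \in s & nrm (x - y) < e.

Lemma compact_tb X : compact (closure X) -> totally_bounded X.
Proof.
rewrite compact_cover => cX e e0.
have [|x clx|D _ hD] := cX V setT (fun y => (ball y e%:C)^°).
- by move=> *; exact: open_interior.
- exists x => //; apply: nbhsx_ballx; by rewrite ltcR.
exists (finmap.enum_fset D) => x Xx; have [y /= yD] := hD x (subset_closure Xx).
by move=> /interior_subset/ballnrm; rewrite nrmBC; exists y.
Qed.

(** An ultrafilter on the closure contains a ball of each radius, since it cannot contain the
    complements of all balls of a finite net; so it is Cauchy. *)
Lemma tb_compact X : totally_bounded X -> compact (closure X).
Proof.
move=> tX; rewrite compact_ultra => F FU FX.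
have FC : cauchy F.
  apply/cauchy_exP => e /posC[r r0 ->].
  have r2 : 0 < r / 2 by rewrite divr_gt0.
  have [s hs] := tX _ r2; apply: contrapT => nF.
  have {}nF y : F (~` ball y r%:C).
    by have [Fy|//] := in_ultra_setVsetC (ball y r%:C) FU; case: nF; exists y.
  have Fs : F [set x | forall y, y \in s -> ~ ball y r%:C x].
    elim: s {hs} => [|y s IH]; first by apply: filterS filterT => x _ y.
    apply: filterS (filterI (nF y) IH) => x [/= nx hx] z.
    by rewrite inE => /predU1P[->|/hx].
  have [x [clx /= hx]] := filter_ex (filterI FX Fs).
  have [z Xz xz] := (closureE_adh X x).1 clx _ r2.
  have [y ys yz] := hs z Xz; apply: (hx y ys); apply/ballnrm.
  rewrite nrmBC; apply: le_lt_trans (nrm_triB z _ _) _.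
  by rewrite [r]splitr ltrD.
have /cauchy_cvgP Fc := FC.
exists (lim F); split=> //.
by apply: closed_closure => B /Fc FB; exact: filter_ex (filterI FX FB).
Qed.

Lemma tb_cluster X (u : nat -> V) : totally_bounded X -> (forall n, X (u n)) ->
  exists p, forall e : R, 0 < e -> forall N, exists2 n, (N <= n)%N & nrm (u n - p) < e.
Proof.
move=> /tb_compact cX uX.
have [|p [_ clp]] := cX (u @ \oo) _.
  by exists 0%N => // n _ /=; exact/subset_closure/uX.
exists p => e e0 N.
have h1 : (u @ \oo) (u @` [set n | (N <= n)%N]) by exists N => // n Nn; exists n.
have h2 : nbhs p (ball p e%:C) by apply: nbhsx_ballx; rewrite ltcR.
have [_ [[n /= Nn <-] /ballnrm]] := clp _ _ h1 h2.
by rewrite nrmBC; exists n.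
Qed.

Lemma tbS X Y : Y `<=` X -> totally_bounded X -> totally_bounded Y.
Proof. by move=> YX tX e e0; have [s hs] := tX e e0; exists s => x /YX/hs. Qed.

Lemma tb_approx X :
  (forall e : R, 0 < e -> exists2 Y, totally_bounded Y &
     forall x, X x -> exists2 y, Y y & nrm (x - y) < e) -> totally_bounded X.
Proof.
move=> h e e0; have e2 : 0 < e / 2 by rewrite divr_gt0.
have [Y tY XY] := h _ e2; have [s hs] := tY _ e2; exists s => x /XY[y Yy xy].
have [z zs yz] := hs y Yy; exists z => //.
by apply: le_lt_trans (nrm_triB y _ _) _; rewrite [e]splitr ltrD.
Qed.

Lemma tb_add X Y : totally_bounded X -> totally_bounded Y -> totally_bounded (setsum X Y).
Proof.
move=> tX tY e e0; have e2 : 0 < e / 2 by rewrite divr_gt0.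
have [s hs] := tX _ e2; have [t ht] := tY _ e2.
exists [seq a + b | a <- s, b <- t] => _ [x Xx [y Yy <-]].
have [a sa xa] := hs x Xx; have [b bt yb] := ht y Yy.
exists (a + b); first by apply/allpairsP; exists (a, b).
rewrite opprD addrACA; apply: le_lt_trans (nrmD _ _) _.
by rewrite [e]splitr ltrD.
Qed.

Lemma tb_image X (f : V -> V) (C : R) :
  (forall x y, nrm (f x - f y) <= C * nrm (x - y)) -> totally_bounded X -> totally_bounded (f @` X).
Proof.
move=> fC tX e e0; have Cp : 0 < `|C| + 1 by rewrite ltr_wpDl.
have [s hs] := tX _ (divr_gt0 e0 Cp); exists (map f s) => _ [x Xx <-].
have [y ys xy] := hs x Xx; exists (f y); first exact: map_f.
apply: le_lt_trans (fC _ _) _; rewrite ltr_pdivlMr// in xy.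
apply: le_lt_trans xy; rewrite mulrC ler_wpM2l ?nrm_ge0//.
by apply: le_trans (ler_norm _) _; rewrite lerDl.
Qed.

Lemma tb_segment v : totally_bounded [set r%:C *: v | r in [set r : R | `|r| <= 1]].
Proof.
(* [d] is the mesh of a grid on [[-1, 1]]; the [+ 1] covers [v = 0] and makes the final inequality
   strict. *)
move=> e e0; pose d := e / (nrm v + 1).
have vp : 0 < nrm v + 1 by rewrite ltr_wpDl ?nrm_ge0.
have d0 : 0 < d by rewrite divr_gt0.
pose N := Num.truncn (2 / d).
exists [seq (k%:R * d - 1)%:C *: v | k <- iota 0 N.+1] => _ [r r1 <-]; rewrite /mkset in r1.
have {r1}/andP[rl rr] : -1 <= r <= 1 by rewrite -ler_norml.
pose k := Num.truncn ((r + 1) / d).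
have rd0 : 0 <= (r + 1) / d by rewrite divr_ge0 ?(ltW d0)//; lra.
exists ((k%:R * d - 1)%:C *: v).
  apply/mapP; exists k => //; rewrite mem_iota /= add0n ltnS.
  apply: le_truncn; rewrite ler_pM2r ?invr_gt0//; lra.
have /andP[k1 k2] := truncn_itv rd0.
rewrite ler_pdivlMr// in k1; rewrite ltr_pdivrMr// -natr1 mulrDl mul1r in k2.
rewrite -scalerBl -rmorphB/= nrmZr.
have h : `|r - (k%:R * d - 1)| <= d by rewrite ler_norml; apply/andP; split; lra.
apply: le_lt_trans (ler_wpM2r (nrm_ge0 v) h) _.
by rewrite /d -mulrA gtr_pMr// ltr_pdivrMl// mulr1 ltrDl.
Qed.

Lemma tb_disc v : totally_bounded [set c *: v | c in [set c : R[i] | `|c| <= 1]].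
Proof.
apply: tbS (tb_add (tb_segment v) (tb_segment ('i *: v))) => _ [c /= c1 <-].
have re1 : `|complex.Re c| <= 1.
  by rewrite -lecR; apply: le_trans (normc_ge_Re _) c1.
have im1 : `|complex.Im c| <= 1.
  have i1 : `|'i%C : R[i]| = 1 by rewrite normc_def/= expr0n/= add0r expr1n sqrtr1.
  have : `|- c * 'i%C| <= 1 by rewrite normrM normrN i1 mulr1.
  rewrite -lecR; apply: le_trans; apply: le_trans (normc_ge_Re _).
  by rewrite lecR mulNr ReN ReiNIm opprK.
exists ((complex.Re c)%:C *: v); first by exists (complex.Re c).
exists ((complex.Im c)%:C *: ('i *: v)); first by exists (complex.Im c).
by rewrite scalerA -scalerDl {3}[c]complexE (mulrC 'i%C).
Qed.

Lemma tb_comb (I : Type) (r : seq I) (v : I -> V) :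
  totally_bounded [set \sum_(i <- r) c i *: v i | c in [set c : I -> R[i] | forall i, `|c i| <= 1]].
Proof.
elim: r => [|i r IH].
  by move=> e e0; exists [:: 0] => _ [c _ <-]; exists 0; rewrite ?inE// big_nil subrr nrm0.
apply: tbS (tb_add (tb_disc (v i)) IH) => _ [c /= hc <-]; rewrite big_cons.
exists (c i *: v i); first by exists (c i) => //; exact: hc.
by exists (\sum_(j <- r) c j *: v j) => //; exists c.
Qed.

End TotallyBounded.

(** * The Fredholm alternative *)

Section Riesz.
Variables (R : realType) (V : completeNormedModType R[i]) (ip : V -> V -> R[i]).
Context {hip : hilbert_inner ip}.
Local Notation "<| x , y |>" := (reip ip x y).
Implicit Types (x y z : V).

Section IdMinusCompact.
Variables (T : set V) (K : V -> V) (C : R).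
Hypotheses (hT : closed_subspace T) (linK : lin K)
  (KC : forall x, nrm (K x) <= C * nrm x) (KT : forall t, T t -> T (K t))
  (tbK : totally_bounded (K @` [set t | T t /\ nrm t <= 1]))
  (injK : forall t, T t -> t - K t = 0 -> t = 0).
Let L x := x - K x.

Let linL : lin L.
Proof. by move=> a x y; rewrite /L linK scalerBr addrACA opprD. Qed.

Let LC x : nrm (L x) <= (1 + C) * nrm x.
Proof. by apply: le_trans (nrmB _ _) _; rewrite mulrDl mul1r lerD2l. Qed.

Let LT t : T t -> T (L t).
Proof. by move=> Tt; apply: subB => //; [exact: hT.1|exact: KT]. Qed.

(** Otherwise there are unit vectors [u n] with [L (u n)] tending to 0. A cluster point [p] of
    [K (u n)] is then one of [u n] too, so [L p = 0] and [p = 0], against the unit norms. *)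
Lemma id_minus_compact_bounded_below :
  exists2 c : R, 0 < c & forall t, T t -> c * nrm t <= nrm (t - K t).
Proof.
apply: contrapT => nb.
have uex (n : nat) : exists u, [/\ T u, nrm u = 1 & nrm (L u) < n.+1%:R^-1].
  apply: contrapT => h; apply: nb; exists (n.+1%:R^-1); first by rewrite invr_gt0.
  move=> t Tt; rewrite leNgt; apply/negP => ht; apply: h.
  have tp : 0 < nrm t.
    rewrite lt_neqAle eq_sym nrm_ge0 andbT; apply/negP => /eqP t0.
    by move: ht; rewrite t0 mulr0 ltNge nrm_ge0.
  exists ((nrm t)^-1%:C *: t); split; first exact: (subZ _ hT.1).
    by rewrite nrmZr normfV gtr0_norm// mulVf ?gt_eqF.
  by rewrite linZ// nrmZr normfV gtr0_norm// ltr_pdivrMl// mulrC.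
have [u hu] := choice uex.
have [|p hp] := tb_cluster (u := K \o u) tbK.
  by move=> n; exists (u n) => //; have [? u1 _] := hu n; split=> //; rewrite u1.
have C1 : 0 <= 1 + C.
  have [_ u1 _] := hu 0%N; have := LC (u 0%N); rewrite u1 mulr1.
  exact: le_trans (nrm_ge0 _).
have app (e : R) : 0 < e -> exists n, [/\ nrm (L (u n)) < e, nrm (K (u n) - p) < e
    & nrm (u n - p) < 2 * e].
  move=> e0; have [N hN] := small_inv e0; have [n Nn hn] := hp e e0 N.
  have h1 : nrm (L (u n)) < e.
    have [_ _ h] := hu n; apply: lt_trans h _; apply: le_lt_trans hN.
    by rewrite lef_pV2 ?posrE// ler_nat.
  exists n; split => //; apply: le_lt_trans (nrm_triB (K (u n)) _ _) _.
  by rewrite mulr_natl mulr2n; exact: ltrD.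
have Tp : T p.
  have [_ /closedP cT] := hT; apply: cT => e e0; have [n [_ h _]] := app e e0.
  by exists (K (u n)); [apply: KT; case: (hu n)|rewrite nrmBC].
have p0 : p = 0.
  apply: injK => //; apply/nrm_eq0/le_anti; rewrite nrm_ge0 andbT.
  apply/ler_addgt0Pl => e e0; rewrite addr0.
  (* [L p = L (u n) - L (u n - p)] has norm at most [d + (1 + C) (2 d)]. *)
  have Dp : 0 < 2 * (1 + C) + 1 by lra.
  have [n [h1 _ h3]] := app _ (divr_gt0 e0 Dp).
  set d := e / _ in h1 h3.
  have -> : p - K p = L (u n) - L (u n - p) by rewrite linB// subKr.
  apply: le_trans (nrmB _ _) _; apply: le_trans (lerD (ltW h1) (LC _)) _.
  apply: le_trans (lerD (lexx _) (ler_wpM2l C1 (ltW h3))) _.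
  have -> : d + (1 + C) * (2 * d) = d * (2 * (1 + C) + 1) by ring.
  by rewrite /d divfK// gt_eqF.
have h2 : 0 < 2^-1 :> R by rewrite invr_gt0.
have [n [_ _]] := app _ h2; rewrite p0 subr0.
have [_ -> _] := hu n; lra.
Qed.

(** Riesz's argument: if [y] is missed, the ranges [M n] of the powers of [L] decrease strictly, and
    unit vectors of [M n] orthogonal to [M n.+1] have images under [K] at mutual distance at least
    1. *)
Lemma id_minus_compact_surj y : T y -> exists2 t, T t & t - K t = y.
Proof.
move=> Ty; apply: contrapT => ny.
have [c c0 Lc] := id_minus_compact_bounded_below.
pose M n := iter n (fun X => L @` X) T.
have MT n : M n `<=` T /\ closed_subspace (M n).
  elim: n => [|n [sT cM]]; first by split.
  split; first by move=> _ [x /sT Tx <-]; exact: LT.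
  by apply: (image_closed cM linL c0 LC) => t /sT; exact: Lc.
have Mdec n : M n.+1 `<=` M n.
  elim: n => [|n IH]; first by move=> _ [x Tx <-]; exact: LT.
  by move=> _ [x Mx <-]; exists x => //; exact: IH.
have Mle n m : (n <= m)%N -> M m `<=` M n.
  move=> /subnKC <-; elim: (m - n)%N => [|k IH]; first by rewrite addn0.
  by rewrite addnS => x /Mdec/IH.
(* Injectivity of [L] carries the gap between [T] and [L T], witnessed by [y], down to every
   level. *)
have yM n : M n (iter n L y) /\ ~ M n.+1 (iter n L y).
  elim: n => [|n [My nM]]; first by split=> // -[t Tt Ly]; apply: ny; exists t.
  split; first by exists (iter n L y).
  move=> -[t Mt /= Lty]; apply: nM; have -> // : iter n L y = t.
  apply/esym/eqP; rewrite -subr_eq0; apply/eqP/injK.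
    by apply: subB; [exact: hT.1|exact: (MT n.+1).1|exact: (MT n).1].
  by rewrite -/(L _) linB// Lty subrr.
have xex n : exists x, [/\ M n x, nrm x = 1 & orth ip (M n.+1) x].
  have [My nM] := yM n; have [z Mz oz] := projection_ex (iter n L y) (MT n.+1).2.
  set w := _ - z in oz; have wp : 0 < nrm w.
    rewrite lt_neqAle eq_sym nrm_ge0 andbT; apply/negP => /eqP/nrm_eq0/eqP.
    by rewrite subr_eq0 => /eqP yz; apply: nM; rewrite yz.
  have Mw : M n w by apply: subB; [exact: (MT n).2.1| |exact: Mdec].
  exists ((nrm w)^-1%:C *: w); split; first exact: (subZ _ (MT n).2.1).
    by rewrite nrmZr normfV gtr0_norm// mulVf ?gt_eqF.
  by apply: (@subZ _ _ (orth ip (M n.+1))) => //; exact: orth_subspace.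
have [x hx] := choice xex.
have [|p hp] := tb_cluster (u := K \o x) tbK.
  move=> n; exists (x n) => //; have [Mx x1 _] := hx n.
  by split; [exact: (MT n).1|rewrite x1].
have h2 : 0 < 2^-1 :> R by rewrite invr_gt0.
have [n _ hn] := hp _ h2 0%N; have [m nm hm] := hp _ h2 n.+1.
have : nrm (K (x n) - K (x m)) < 1.
  apply: le_lt_trans (nrm_triB p _ _) _; rewrite [X in _ < X]splitr mul1r.
  by apply: ltrD => //; rewrite nrmBC.
have [Mn n1 on] := hx n; have [Mm m1 _] := hx m.
(* Chosen so that [K (x n) - K (x m) = x n - v]; since [m > n], [v] is in [M n.+1] and thus
   orthogonal to [x n]. *)
pose v := L (x n) + (x m - L (x m)).
have Mv : M n.+1 v.
  have hM := (MT n.+1).2.1; apply: subD => //; first by exists (x n).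
  apply: subB => //; first exact: (Mle _ _ nm).
  by apply: (Mle _ _ nm); apply: Mdec; exists (x m).
have -> : K (x n) - K (x m) = x n - v.
  by rewrite /v /L subKr opprD addrA subKr.
move=> h; have : nrm (x n - v) ^+ 2 < 1 by rewrite expr_lt1 ?nrm_ge0.
by rewrite nrmB2 n1 (reip0 (on v Mv)); have := sqr_ge0 (nrm v); lra.
Qed.

End IdMinusCompact.
End Riesz.

(** * Orthonormal bases *)

Section Bases.
Variables (R : realType) (V : completeNormedModType R[i]) (ip : V -> V -> R[i]).
Context {hip : hilbert_inner ip}.
Local Notation "<| x , y |>" := (reip ip x y).
Implicit Types (x y z : V) (M B : set V).

(** The real inequality is applied to [x] and [z y] with [z = ip x y], for which the real form
    equals [|z|^2]. *)
Lemma ip_cauchy_schwarz x y : `|ip x y| <= (nrm x * nrm y)%:C.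
Proof.
set z := ip x y; have [a a0 za] : exists2 a : R, 0 <= a & `|z| = a%:C.
  exists (complex.Re `|z|); last by rewrite RRe_real// ger0_real.
  by rewrite -ler0c RRe_real// ger0_real.
have := @cauchy_schwarz _ _ ip hip x (z *: y).
rewrite nrmZ za /= /reip ipZr -/z mulrC -sqr_normc za -rmorphXn/= => h.
rewrite lecR; have [->|an] := eqVneq a 0; first by rewrite mulr_ge0 ?nrm_ge0.
have ap : 0 < a by rewrite lt_neqAle eq_sym an.
by rewrite -(ler_pM2l ap) -expr2 mulrCA.
Qed.

Definition ons M B := [/\ B `<=` M, forall x, B x -> ip x x = 1 &
  forall x y, B x -> B y -> x <> y -> ip x y = 0].

Lemma unit_vector x : x <> 0 -> nrm (((nrm x)^-1)%:C *: x) = 1.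
Proof.
move=> x0; rewrite nrmZr ger0_norm ?invr_ge0 ?nrm_ge0// mulVf//.
by apply/eqP => /nrm_eq0.
Qed.

(** A maximal orthonormal set given by Zorn's lemma is complete: a nonzero vector orthogonal to it
    could be normalized and added. *)
Lemma max_ons M : subspace M ->
  exists2 B, ons M B & forall x, M x -> (forall y, B y -> ip x y = 0) -> x = 0.
Proof.
move=> hM; have [F Fons Ftot|B [hO maxO]] := @Zorn_bigcup V (ons M).
  split=> [x [X /Fons[XM _ _] /XM]//|x [X /Fons[_ h _] /h]//|x y [X FX Xx] [Y FY Yy]].
  by have [XY|YX] := Ftot _ _ FX FY;
    [have [_ _] := Fons _ FY; apply=> //; exact: XY|
     have [_ _] := Fons _ FX; apply=> //; exact: YX].
exists B => // x Mx ox; apply: contrapT => x0.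
have [OM O1 Oo] := hO; pose u := ((nrm x)^-1)%:C *: x.
have ou y : B y -> ip u y = 0 by move=> Oy; rewrite ipZl ox// mulr0.
have u1 : ip u u = 1 by rewrite ipxx unit_vector// expr1n.
have nOu : ~ B u by move=> /ou; rewrite u1 => /eqP; rewrite oner_eq0.
apply: (maxO (B `|` [set u])).
  by split=> [y Oy|/(_ u)]; [left|move=> h; apply/nOu/h; right].
split=> [y [/OM//|->]|y [/O1//|->//]|y z [Oy|->] [Oz|->]//].
- exact: subZ.
- exact: Oo.
- by move=> _; apply: ip_eq0C; exact: ou.
- by move=> _; exact: ou.
Qed.

(** Distinct orthonormal vectors are at distance [sqrt 2], so points of the dense set within 1/2 of
    them are distinct. *)
Lemma ons_countable M B : separable_space V -> ons M B -> countable B.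
Proof.
move=> [D [cD dD]] [_ O1 Oo].
have gex x : exists y, D y /\ nrm (x - y) < 2^-1.
  have : closure D x by rewrite dD.
  by move=> /closureE_adh/(_ 2^-1); rewrite invr_gt0 ltr0n => /(_ isT)[y]; exists y.
have [g hg] := choice gex; have /countable_injP[f finj] := cD.
apply/countable_injP; exists (f \o g) => x y /set_mem Ox /set_mem Oy /= fxy.
have gxy : g x = g y by apply: finj => //; apply/mem_set; [case: (hg x)|case: (hg y)].
apply: contrapT => nxy.
have n1 z : B z -> nrm z ^+ 2 = 1 by move=> /O1; rewrite ipxx => -[].
have : nrm (x - y) < 1.
  apply: le_lt_trans (nrm_triB (g x) _ _) _; rewrite [X in _ < X]splitr mul1r.
  apply: ltrD; first by case: (hg x).
  by rewrite gxy nrmBC; case: (hg y).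
move=> h; have : nrm (x - y) ^+ 2 < 1 by rewrite expr_lt1 ?nrm_ge0.
by rewrite nrmB2 !n1// (reip0 (Oo _ _ Ox Oy nxy)); lra.
Qed.

(** Only the first [n] values of [e] matter; indexing by [nat] makes it easy to truncate a basis or
    compare two sizes. *)
Definition fin_onb M (n : nat) (e : nat -> V) :=
  [/\ forall i, (i < n)%N -> M (e i),
      forall i j, (i < n)%N -> (j < n)%N -> ip (e i) (e j) = (i == j)%:R &
      forall x, M x -> (forall i, (i < n)%N -> ip x (e i) = 0) -> x = 0].

(** Separability enters here: every infinite basis can be indexed by [nat], so any two
    infinite-dimensional subspaces can be paired. *)
Lemma basis_dichotomy M : separable_space V -> subspace M ->
  (exists n e, fin_onb M n e) \/ (exists e : nat -> V, orthonormal_basis ip M e).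
Proof.
move=> hsep hM; have [B hO maxO] := max_ons hM; have cO := ons_countable hsep hO.
have [OM O1 Oo] := hO.
have [/finite_seqP[s Os]|iO] := pselect (finite_set B); [left|right].
  pose t := undup s; exists (size t), (nth 0 t).
  have Ot i : (i < size t)%N -> B (nth 0 t i).
    by move=> it; rewrite Os /= -mem_undup mem_nth.
  split=> [i /Ot/OM//|i j it jt|x Mx ox].
    have [->|ij] := eqVneq i j; first by rewrite O1//; exact: Ot.
    apply: Oo; [exact: Ot|exact: Ot|apply/eqP].
    by rewrite nth_uniq// undup_uniq.
  apply: maxO => // y; rewrite Os /= -mem_undup => yt.
  by rewrite -(nth_index 0 yt); apply: ox; rewrite index_mem.
have /card_esym/card_set_bijP[e [eO einj esurj]] : (B #= [set: nat])%card.
  by rewrite card_eq_le; apply/andP; split=> //; exact/infiniteP.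
exists e; split=> [i|i|i j ij|x Mx ox].
- exact/OM/eO.
- exact/O1/eO.
- by apply: Oo; [exact: eO|exact: eO|move=> eij; apply: ij; apply: einj; rewrite ?inE].
- by apply: maxO => // y /esurj[i _ <-].
Qed.

Lemma fin_onb_expand M n e x : subspace M -> fin_onb M n e -> M x ->
  x = \sum_(i < n) ip x (e i) *: e i.
Proof.
move=> hM [Me eo maxe] Mx; apply/eqP; rewrite -subr_eq0; apply/eqP/maxe.
  by apply: subB => //; apply: sub_sum => // i; apply: subZ => //; exact: Me.
move=> j jn; rewrite ipBl ip_suml (bigD1 (Ordinal jn))//= ipZl eo// eqxx mulr1.
rewrite big1 ?addr0 ?subrr// => i ij; rewrite ipZl eo//.
by have /negbTE : (i : nat) != j by []; move=> ->; rewrite mulr0.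
Qed.

Lemma tb_fin M n e : subspace M -> fin_onb M n e -> totally_bounded [set x | M x /\ nrm x <= 1].
Proof.
move=> hM he; apply: tbS (tb_comb (index_enum 'I_n) (fun i : 'I_n => e i)).
move=> x [Mx x1]; exists (fun i : 'I_n => ip x (e i)); last first.
  by rewrite -(fin_onb_expand hM he Mx).
move=> i /=; apply: le_trans (ip_cauchy_schwarz _ _) _; rewrite lecR.
have -> : nrm (e i) = 1; last by rewrite mulr1.
have [_ eo _] := he; have := eo i i; rewrite ltn_ord eqxx ipxx => /(_ isT isT)[] /eqP.
by rewrite sqrf_eq1 => /orP[/eqP//|/eqP h]; have := nrm_ge0 (e i); rewrite h; lra.
Qed.

(** If [M'] had an infinite orthonormal sequence, the [(n+1) x n] matrix of coordinates of [n + 1]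
    images would have a nonzero left kernel vector, that is, a combination killed by [L]. *)
Lemma fin_onb_inj M M' n e (L : V -> V) : separable_space V -> subspace M -> subspace M' ->
  fin_onb M n e -> lin L -> (forall x, M' x -> M (L x)) ->
  (forall x, M' x -> L x = 0 -> x = 0) -> exists n' e', fin_onb M' n' e'.
Proof.
move=> hsep hM hM' he hL LM Linj.
have [//|[f [fM f1 fo _]]] := basis_dichotomy hsep hM'.
pose A : 'M[R[i]]_(n.+1, n) := \matrix_(i, j) ip (L (f i)) (e j).
have [v v0 vA] : exists2 v : 'rV_n.+1, v != 0 & v *m A = 0.
  have : kermx A != 0.
    rewrite -mxrank_eq0 mxrank_ker subn_eq0 -ltnNge ltnS.
    exact: rank_leq_col.
  by move=> /rowV0Pn[v /sub_kermxP vA v0]; exists v.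
case/negP: v0; apply/eqP/rowP => j; rewrite mxE.
pose x := \sum_(i < n.+1) v 0 i *: f i.
have x0 : x = 0.
  have M'x : M' x by apply: sub_sum => // i; apply: subZ.
  apply: Linj => //; rewrite (fin_onb_expand hM he (LM _ M'x)).
  rewrite big1// => k _; have /matrixP/(_ 0 k) := vA; rewrite !mxE => h.
  suff -> : ip (L x) (e k) = 0 by rewrite scale0r.
  rewrite -h lin_sum// ip_suml; apply: eq_bigr => i _.
  by rewrite linZ// ipZl mxE.
have : ip x (f j) = 0 by rewrite x0 ip0l.
rewrite ip_suml (bigD1 j)//= ipZl f1 mulr1 big1 ?addr0// => i ij.
rewrite ipZl fo ?mulr0// => h; case/negP: ij; apply/eqP/val_inj.
exact: h.
Qed.

End Bases.

(** * Absolute value of a self-adjoint operator *)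

Section Limits.
Variables (R : realType) (V : completeNormedModType R[i]) (ip : V -> V -> R[i]).
Context {hip : hilbert_inner ip}.
Local Notation "<| x , y |>" := (reip ip x y).
Implicit Types (x y z : V) (u v : nat -> V).

Lemma eq_lim x y (C : R) : (forall e : R, 0 < e -> nrm (x - y) <= C * e) -> x = y.
Proof.
move=> h; apply/eqP; rewrite -subr_eq0; apply/eqP/nrm_eq0/le_anti.
rewrite nrm_ge0 andbT; apply/ler_addgt0Pl => e e0; rewrite addr0.
have Cp : 0 < `|C| + 1 by rewrite ltr_wpDl.
apply: le_trans (h _ (divr_gt0 e0 Cp)) _; rewrite mulrCA ler_piMr ?(ltW e0)//.
by rewrite ler_pdivrMr// mul1r; have := ler_norm C; lra.
Qed.

Lemma cvs_uniq u x y : cvs u x -> cvs u y -> x = y.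
Proof.
move=> ux uy; apply: (@eq_lim _ _ 2) => e e0.
have [N hN] := ux _ e0; have [K hK] := uy _ e0.
apply: le_trans (nrm_triB (u (maxn N K)) _ _) _; rewrite mulr_natl mulr2n nrmBC.
by apply: lerD; apply: ltW; [apply: hN; exact: leq_maxl|apply: hK; exact: leq_maxr].
Qed.

Lemma cvs_ext u v x : u =1 v -> cvs u x -> cvs v x.
Proof. by move=> uv ux e e0; have [N hN] := ux e e0; exists N => n; rewrite -uv; exact: hN. Qed.

Lemma cvs_cst x : cvs (fun=> x) x.
Proof. by move=> e e0; exists 0%N => n _; rewrite subrr nrm0. Qed.

Lemma cvsS u x : cvs u x -> cvs (fun n => u n.+1) x.
Proof. by move=> ux e e0; have [N hN] := ux e e0; exists N => n Nn; apply: hN; exact: leqW. Qed.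

Lemma cvsD u v x y : cvs u x -> cvs v y -> cvs (fun n => u n + v n) (x + y).
Proof.
move=> ux vy e e0; have e2 : 0 < e / 2 by rewrite divr_gt0.
have [N hN] := ux _ e2; have [K hK] := vy _ e2; exists (maxn N K) => n.
rewrite geq_max => /andP[/hN h1 /hK h2]; rewrite opprD addrACA.
by apply: le_lt_trans (nrmD _ _) _; rewrite [e]splitr ltrD.
Qed.

Lemma cvs_lip u x (D : V -> V) (C : R) :
  (forall y z, nrm (D y - D z) <= C * nrm (y - z)) -> cvs u x -> cvs (fun n => D (u n)) (D x).
Proof.
move=> DC ux e e0; have Cp : 0 < `|C| + 1 by rewrite ltr_wpDl.
have [N hN] := ux _ (divr_gt0 e0 Cp); exists N => n /hN h.
apply: le_lt_trans (DC _ _) _; rewrite ltr_pdivlMr// in h; apply: le_lt_trans h.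
rewrite mulrC ler_wpM2l ?nrm_ge0//; apply: le_trans (ler_norm _) _.
by rewrite lerDl.
Qed.

Lemma lin_lip (D : V -> V) (C : R) : lin D -> (forall x, nrm (D x) <= C * nrm x) ->
  forall y z, nrm (D y - D z) <= C * nrm (y - z).
Proof. by move=> hD DC y z; rewrite -linB. Qed.

Lemma cvsZ u x (a : R[i]) : cvs u x -> cvs (fun n => a *: u n) (a *: x).
Proof.
apply: (cvs_lip (D := fun y => a *: y) (C := complex.Re `|a|)) => y z.
by rewrite -scalerBr nrmZ.
Qed.

Lemma cvs_reip u v x y x' y' : cvs u x -> cvs v y ->
  (forall n, <|u n, y'|> = <|x', v n|>) -> <|x, y'|> = <|x', y|>.
Proof.
move=> ux vy h; apply/eqP; rewrite -subr_eq0 -normr_le0; apply/ler_addgt0Pl => e e0.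
rewrite addr0; have Cp : 0 < nrm x' + nrm y' + 1.
  by rewrite ltr_wpDl// addr_ge0 ?nrm_ge0.
have [N hN] := ux _ (divr_gt0 e0 Cp); have [K hK] := vy _ (divr_gt0 e0 Cp).
set n := maxn N K; have {}hN := hN n (leq_maxl _ _); have {}hK := hK n (leq_maxr _ _).
set d := e / _ in hN hK.
have -> : <|x, y'|> - <|x', y|> = <|x', v n - y|> - <|u n - x, y'|>.
  by rewrite !reipD -h; ring.
apply: le_trans (ler_normB _ _) _.
have h1 := le_trans (@abs_cauchy_schwarz _ _ ip hip x' (v n - y))
  (ler_wpM2l (nrm_ge0 x') (ltW hK)).
have h2 := le_trans (@abs_cauchy_schwarz _ _ ip hip (u n - x) y')
  (ler_wpM2r (nrm_ge0 y') (ltW hN)).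
have d0 : 0 < d by rewrite divr_gt0.
apply: le_trans (lerD h1 h2) _; have -> : e = d * (nrm x' + nrm y' + 1).
  by rewrite /d divfK// gt_eqF.
by nra.
Qed.

End Limits.

Section AbsoluteValue.
Variables (R : realType) (V : completeNormedModType R[i]) (ip : V -> V -> R[i]).
Context {hip : hilbert_inner ip}.
Local Notation "<| x , y |>" := (reip ip x y).
Implicit Types (x y z : V).

Definition selfadj (L : V -> V) := forall x y, <|L x, y|> = <|x, L y|>.

Variable X : V -> V.
Hypotheses (linX : lin X) (saX : selfadj X) (X1 : forall x, nrm (X x) <= nrm x).

(** [1 - C] is the square of [X], so its positive square root is the absolute value of [X]. *)
Let C x := x - X (X x).

(* The iteration Q <- (C + Q^2) / 2 from Q = 0 increases to 1 - sqrt (1 - C);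
   [q n] runs the same recursion on the norms, which bounds its increments. *)
Fixpoint sqrt_iter (n : nat) (x : V) : V :=
  if n is m.+1 then (2^-1)%:C *: (C x + sqrt_iter m (sqrt_iter m x)) else 0.
Fixpoint sqrt_bound (n : nat) : R :=
  if n is m.+1 then (1 + sqrt_bound m ^+ 2) / 2 else 0.
Local Notation Q := sqrt_iter.
Local Notation q := sqrt_bound.

Let linC : lin C.
Proof. by move=> a x y; rewrite /C !linX scalerBr addrACA opprD. Qed.

Let C1 x : nrm (C x) <= nrm x.
Proof.
apply: nrm_le_sqr; rewrite ?nrm_ge0// nrmB2 -saX reipE.
have : nrm (X (X x)) ^+ 2 <= nrm (X x) ^+ 2 by rewrite ler_sqr ?nnegrE ?nrm_ge0.
by have := sqr_ge0 (nrm (X x)); lra.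
Qed.

Let linQ n : lin (Q n).
Proof.
elim: n => [|n IH] a x y /=; first by rewrite scaler0 addr0.
rewrite linC !IH [a *: (_%:C *: _)]scalerA [a * _%:C]mulrC -scalerA -[RHS]scalerDr; congr (_ *: _).
by rewrite addrACA -scalerDr.
Qed.

Let saQ n : selfadj (Q n).
Proof.
elim: n => [|n IH] x y /=; first by rewrite reip0l reip0r.
by rewrite /C !reipD !saX !IH.
Qed.

Let q01 n : 0 <= q n <= 1.
Proof. by elim: n => [|n /andP[h0 h1]] /=; rewrite ?lexx ?ler01//; apply/andP; split; nra. Qed.

Let Qq n x : nrm (Q n x) <= q n * nrm x.
Proof.
elim: n x => [|n IH] x /=; first by rewrite nrm0 mul0r.
rewrite nrmZr ger0_norm ?invr_ge0//; have /andP[q0 q1] := q01 n.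
have h : nrm (Q n (Q n x)) <= q n ^+ 2 * nrm x.
  by apply: le_trans (IH _) _; rewrite expr2 -mulrA; apply: ler_wpM2l.
have := nrmD (C x) (Q n (Q n x)); have := C1 x; lra.
Qed.

(** Half of [Q'^2 - Q^2 = Q' (Q' - Q) + (Q' - Q) Q] bounds the next increment exactly as the
    factorization of [q'^2 - q^2] does. *)
Let Qd n x : nrm (Q n.+1 x - Q n x) <= (q n.+1 - q n) * nrm x.
Proof.
elim: n x => [|n IH] x.
  rewrite /= subr0 addr0 nrmZr ger0_norm ?invr_ge0// expr0n/= addr0 subr0 mul1r.
  by rewrite ler_wpM2l ?invr_ge0.
have -> : Q n.+2 x - Q n.+1 x =
    (2^-1)%:C *: (Q n.+1 (Q n.+1 x - Q n x) + (Q n.+1 (Q n x) - Q n (Q n x))).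
  rewrite (linB _ _ (linQ n.+1)) addrA subrK.
  rewrite [Q n.+2 x]/(_ *: (C x + Q n.+1 (Q n.+1 x))).
  rewrite [X in _ - X = _]/(_ *: (C x + Q n (Q n x))).
  by rewrite -scalerBr opprD addrACA subrr add0r.
rewrite nrmZr ger0_norm ?invr_ge0//.
have qE : q n.+2 - q n.+1 = (q n.+1 - q n) * (q n.+1 + q n) / 2.
  have e1 : q n.+2 = (1 + q n.+1 ^+ 2) / 2 by [].
  have e2 : q n.+1 = (1 + q n ^+ 2) / 2 by [].
  by rewrite e1 [X in _ - X]e2; move: (q n.+1) (q n) => b c; field.
rewrite qE; have /andP[p0 _] := q01 n.+1; have /andP[p1 _] := q01 n.
have d0 : 0 <= q n.+1 - q n by have := sqr_ge0 (1 - q n); rewrite /=; nra.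
have h1 := le_trans (Qq n.+1 (Q n.+1 x - Q n x)) (ler_wpM2l p0 (IH x)).
have h2 := le_trans (IH (Q n x)) (ler_wpM2l d0 (Qq n x)).
have := le_trans (nrmD _ _) (lerD h1 h2).
set a := nrm _; set b := nrm x; set r := q n.+1; set s := q n => h.
have -> : (r - s) * (r + s) / 2 * b = 2^-1 * (r * ((r - s) * b) + (r - s) * (s * b)).
  by ring.
by rewrite ler_wpM2l ?invr_ge0.
Qed.

Let comQ (D : V -> V) : lin D -> (forall x, D (C x) = C (D x)) ->
  forall n x, D (Q n x) = Q n (D x).
Proof.
move=> hD DC; elim=> [|n IH] x /=; first by rewrite lin0.
by rewrite linZ// linD// DC !IH.
Qed.

(** [Y = 1 - L] for the limit [L] of the iteration: [2 L = C + L^2] gives [Y^2 = 1 - C], and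
    [|L x| <= |x|] gives positivity. The last clause asks for commutation with [X^2], as this is
    what the projections satisfy in the applications. *)
Lemma abs_op_ex : exists Y : V -> V, [/\ lin Y, selfadj Y, forall x, 0 <= <|Y x, x|>,
  forall x, Y (Y x) = X (X x) &
  forall (D : V -> V) (c : R), lin D -> (forall x, nrm (D x) <= c * nrm x) ->
    (forall x, D (X (X x)) = X (X (D x))) -> forall x, D (Y x) = Y (D x)].
Proof.
have limex x : exists l, cvs (fun n => Q n x) l.
  have [| |l ? _] := @cauchy_tele _ _ (fun n => Q n x) (fun n => q n * nrm x) (nrm x).
  - by move=> n; rewrite ler_piMl ?nrm_ge0//; case/andP: (q01 n).
  - by move=> n; rewrite -mulrBl; exact: Qd.
  by exists l.
have [L hL] := choice limex.
have linL : lin L.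
  move=> a x y; apply: cvs_uniq (hL _) _.
  apply: cvs_ext (cvsD (cvsZ a (hL x)) (hL y)) => n.
  by rewrite linQ.
have saL : selfadj L by move=> x y; apply: (cvs_reip (hL x) (hL y)) => n; exact: saQ.
have Q1 n x : nrm (Q n x) <= nrm x.
  by apply: le_trans (Qq _ _) _; rewrite ler_piMl ?nrm_ge0//; case/andP: (q01 n).
have L1 x : nrm (L x) <= nrm x.
  rewrite -[L x]subr0; apply: (cvs_adh_le (N := 0%N) (hL x)) => n _.
  by rewrite subr0.
have LL x : (2^-1)%:C *: (C x + L (L x)) = L x.
  apply: cvs_uniq (cvsS (hL x)); apply: cvsZ; apply: cvsD; first exact: cvs_cst.
  (* The bound [|Q n| <= 1], uniform in [n], lets both factors of [Q n (Q n x)] pass to the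
     limit. *)
  have h : cvs (fun n => Q n (Q n x - L x)) 0.
    move=> e e0; have [N hN] := hL x _ e0; exists N => n /hN h.
    by rewrite subr0; apply: le_lt_trans (Q1 _ _) h.
  have := cvsD h (hL (L x)); rewrite add0r; apply: cvs_ext => n.
  by rewrite linB// subrK.
exists (fun x => x - L x); split.
- by move=> a x y; rewrite linL scalerBr addrACA opprD.
- by move=> x y; rewrite !reipD saL.
- move=> x; rewrite !reipD reipE subr_ge0; apply: le_trans (cauchy_schwarz _ _) _.
  by rewrite expr2 ler_wpM2r ?nrm_ge0.
- move=> x; have e : L x + L x = C x + L (L x).
    by rewrite -{1 2}(LL x) -scalerDl -rmorphD/= -[2^-1]mul1r -splitr scale1r.
  have -> : L (x - L x) = C x - L x.
    by rewrite linB// -[L (L x)](addKr (C x)) -e !opprD !opprK addrCA addNKr.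
  by rewrite opprB addrA subrK /C subKr.
move=> D c hD Dc DX x; rewrite linB//; congr (_ - _).
have DC y : D (C y) = C (D y) by rewrite /C linB// DX.
apply: cvs_uniq (cvs_lip (lin_lip hD Dc) (hL x)) _.
by apply: cvs_ext (hL (D x)) => n; rewrite comQ.
Qed.

End AbsoluteValue.

(** * Common complements from linear relations *)

Section CommonComplement.
Variables (R : realType) (V : completeNormedModType R[i]) (ip : V -> V -> R[i]).
Context {hip : hilbert_inner ip}.
Local Notation "<| x , y |>" := (reip ip x y).
Implicit Types (x y z t s v : V) (S T Z : set V) (G : V -> V -> Prop).

(** A linear subspace of [V x V]; swapping the arguments exchanges the roles of [T] and [S]. *)
Definition linrel G := G 0 0 /\
  forall a t s t' s', G t s -> G t' s' -> G (a *: t + t') (a *: s + s').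

Section Half.
Variables (T : set V) (G : V -> V -> Prop) (d M : R).
Hypotheses (hT : closed_subspace T) (hG : linrel G) (d0 : 0 < d) (M0 : 0 < M)
  (GT : forall t s, G t s -> T t)
  (denseG : forall x, T x -> (forall t s, G t s -> ip x t = 0) -> x = 0)
  (Gd : forall t s, G t s -> d * nrm t ^+ 2 <= <|t, t + s|>)
  (GM : forall t s, G t s -> nrm (t + s) <= M * nrm t).
Let Z := orth ip [set y | exists t s, G t s /\ y = t + s].

Let GTadh t : T t -> adh [set t | exists s, G t s] t.
Proof.
apply: dense_adh.
- split=> [|a x y [s Gx] [s' Gy]]; first by exists 0; exact: hG.1.
  by exists (a *: s + s'); apply: hG.2.
- exact: hT.1.
- by move=> x [s]; exact: GT.
- exact: hT.2.
- by move=> y Ty oy; apply: denseG => // x s Gx; apply: oy; exists s.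
Qed.

(** On the domain of [G], [z] is orthogonal to [x + s], so [d |x|^2 <= <x + z, x + s> <= M |x| |x +
    z|]; density extends this to [T]. *)
Lemma relation_coercive t z : T t -> Z z -> d * nrm t <= M * nrm (t + z).
Proof.
move=> Tt Zz; apply/ler_addgt0Pl => e e0.
have dMp : 0 < M + d by rewrite addr_gt0.
have [x [s Gxs] tx] := GTadh Tt (divr_gt0 e0 dMp); set r := e / _ in tx.
have hx : d * nrm x <= M * nrm (x + z).
  have [x0|x0] := eqVneq (nrm x) 0.
    by rewrite x0 mulr0 mulr_ge0 ?nrm_ge0// ltW.
  have xp : 0 < nrm x by rewrite lt_neqAle eq_sym x0 nrm_ge0.
  rewrite -(ler_pM2r xp) -mulrA -expr2; apply: le_trans (Gd Gxs) _.
  have -> : <|x, x + s|> = <|x + z, x + s|>.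
    by rewrite [RHS]reipDl (reip0 (Zz (x + s) _)) ?addr0//; exists x, s.
  apply: le_trans (cauchy_schwarz _ _) _; rewrite -mulrA [_ * (_ * nrm x)]mulrCA.
  by rewrite ler_wpM2l ?nrm_ge0//; exact: GM.
have h1 : nrm t <= nrm x + r.
  by have := nrmD x (t - x); rewrite addrC subrK; have := tx; lra.
have h2 : nrm (x + z) <= nrm (t + z) + r.
  have := nrmD (t + z) (x - t).
  have -> : t + z + (x - t) = x + z by rewrite addrAC [t + _]addrC subrK.
  by rewrite [nrm (x - t)]nrmBC; have := tx; lra.
(* Replacing [t] by [x] costs [d r] on one side and [M r] on the other. *)
have -> : e = (M + d) * r by rewrite /r mulrC divfK// gt_eqF.
have := ler_wpM2l (ltW d0) h1; have := ler_wpM2l (ltW M0) h2; lra.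
Qed.

Lemma relation_disjoint : T `&` Z = [set 0].
Proof.
apply/seteqP; split=> [x [Tx Zx]|_ ->]; last first.
  by split; [exact: hT.1.1|exact: (orth_subspace _).1].
have := @relation_coercive x (- x) Tx; rewrite subrr nrm0 mulr0 => h.
apply/nrm_eq0/le_anti; rewrite nrm_ge0 andbT -(pmulr_rle0 _ d0); apply: h.
by apply: (@subN _ _ Z) => //; exact: orth_subspace.
Qed.

(** [v] is a limit of sums [t + s]. As [v] is orthogonal to [t], [d |t| <= |t + s - v|], so [t], and
    with it [t + s], tends to 0. *)
Let orthTZ v : orth ip T v -> orth ip Z v -> v = 0.
Proof.
move=> oT oZ; pose Y0 := [set y | exists t s, G t s /\ y = t + s].
have sY0 : subspace Y0.
  split; first by exists 0, 0; rewrite addr0; split=> //; exact: hG.1.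
  move=> a _ _ [t [s [Gt ->]]] [t' [s' [Gt' ->]]].
  exists (a *: t + t'), (a *: s + s'); split; first exact: hG.2.
  by rewrite scalerDr addrACA.
have av : adh Y0 v.
  apply: (@orth_orth _ _ ip); first by split; [exact: adh_subspace|exact: adh_closed].
  by move=> y oy; apply: oZ => w Yw; apply: oy; exact: adhW.
apply: (@eq_lim _ _ _ _ (1 + M / d)) => e e0; rewrite subr0.
have [_ [t [s [Gt ->]]] h] := av e e0.
have td : nrm t <= e / d.
  rewrite ler_pdivlMr// mulrC; have [t0|t0] := eqVneq (nrm t) 0.
    by rewrite t0 mulr0 ltW.
  have tp : 0 < nrm t by rewrite lt_neqAle eq_sym t0 nrm_ge0.
  rewrite -(ler_pM2r tp) -mulrA -expr2; apply: le_trans (Gd Gt) _.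
  have -> : <|t, t + s|> = <|t, t + s - v|>.
    by rewrite [RHS]reipDr reipNr [<|t, v|>]reipC (reip0 (oT t (GT Gt))) subr0.
  apply: le_trans (cauchy_schwarz _ _) _; rewrite mulrC ler_wpM2r ?nrm_ge0//.
  by rewrite nrmBC ltW.
have -> : v = (v - (t + s)) + (t + s) by rewrite subrK.
apply: le_trans (nrmD _ _) _; apply: le_trans (lerD (ltW h) (GM Gt)) _.
rewrite mulrDl mul1r lerD2l -mulrA [d^-1 * e]mulrC.
by rewrite ler_wpM2l// ltW.
Qed.

(** Modulo [Z], coercivity makes the image of [T] closed in the orthogonal complement of [Z]; what
    is orthogonal to that image there is orthogonal to [T], so [orthTZ] applies. *)
Lemma relation_span x : exists t z, [/\ T t, Z z & x = t + z].
Proof.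
have hZ : closed_subspace Z by exact: orth_closed_subspace.
have [P hP] := proj_ex hZ; have linP := proj_lin hZ.1 hP.
pose L x := x - P x.
have linL : lin L by move=> a y z; rewrite /L linP scalerBr addrACA opprD.
have oL y : orth ip Z (L y) by exact: (hP y).2.
have cI : closed_subspace (L @` T).
  apply: (image_closed (c := d / M) (C := 1)) => //; first by rewrite divr_gt0.
    move=> y; rewrite mul1r; apply: nrm_le_sqr; rewrite ?nrm_ge0//.
    by rewrite (proj_pyth hP y) lerDr sqr_ge0.
  move=> t Tt; rewrite mulrAC ler_pdivrMr// [nrm _ * _]mulrC.
  apply: relation_coercive => //; apply: (@subN _ _ Z) => //; first exact: hZ.1.
  exact: (proj_in hP).
have [_ [t Tt <-] ot] := projection_ex (L x) cI.
have : L x - L t = 0.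
  apply: orthTZ => [y Ty|]; last first.
    by rewrite -linB//; exact: oL.
  have -> : y = L y + P y by rewrite /L subrK.
  rewrite ipDr ot; last by exists y.
  by rewrite -linB// (oL (x - t)) ?addr0//; exact: (proj_in hP).
move=> /eqP; rewrite subr_eq0 => /eqP LL.
exists t, (P x - P t); split=> //.
  by apply: (@subB _ _ Z) => //; [exact: hZ.1|exact: (proj_in hP)|exact: (proj_in hP)].
by rewrite -[LHS](subrK (P x)) -/(L x) LL /L addrA addrAC.
Qed.

End Half.

Lemma relation_common_complement S T G (d M : R) :
  closed_subspace S -> closed_subspace T -> linrel G -> 0 < d -> 0 < M ->
  (forall t s, G t s -> T t /\ S s) ->
  (forall x, T x -> (forall t s, G t s -> ip x t = 0) -> x = 0) ->
  (forall x, S x -> (forall t s, G t s -> ip x s = 0) -> x = 0) ->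
  (forall t s, G t s -> d * nrm t ^+ 2 <= <|t, t + s|>) ->
  (forall t s, G t s -> d * nrm s ^+ 2 <= <|s, t + s|>) ->
  (forall t s, G t s -> nrm s <= M * nrm t) ->
  (forall t s, G t s -> nrm t <= M * nrm s) ->
  common_complement S T.
Proof.
move=> hS hT hG d0 M0 GTS dT dS Gt Gs Ms Mt.
pose G' s t := G t s.
have hG' : linrel G' by split=> [|a s t s' t' h h']; [exact: hG.1|exact: hG.2].
have M1 : 0 < 1 + M by lra.
have b1 t s : G t s -> nrm (t + s) <= (1 + M) * nrm t.
  by move=> /Ms h; apply: le_trans (nrmD _ _) _; lra.
have b2 s t : G' s t -> nrm (s + t) <= (1 + M) * nrm s.
  by move=> /Mt h; apply: le_trans (nrmD _ _) _; lra.
have e2 s t : G' s t -> d * nrm s ^+ 2 <= <|s, s + t|>.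
  by move=> /Gs; rewrite addrC.
have T1 t s : G t s -> T t by move=> /GTS[].
have S1 s t : G' s t -> S s by move=> /GTS[].
have d2 x : S x -> (forall s t, G' s t -> ip x s = 0) -> x = 0.
  by move=> Sx h; apply: dS => // t s /h.
have ZE : [set y | exists t s, G t s /\ y = t + s] = [set y | exists s t, G' s t /\ y = s + t].
  by apply/seteqP; split=> y [a [b [h ->]]]; exists b, a; rewrite addrC.
exists (orth ip [set y | exists t s, G t s /\ y = t + s]); split.
- exact: orth_closed_subspace.
- by rewrite ZE; apply: (relation_disjoint hS hG' d0 M1 S1 d2 e2 b2).
- exact: (relation_disjoint hT hG d0 M1 T1 dT Gt b1).
- by rewrite ZE; apply: (relation_span hS hG' d0 M1 S1 d2 e2 b2).
- exact: (relation_span hT hG d0 M1 T1 dT Gt b1).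
Qed.

End CommonComplement.

(** * The Fredholm obstruction to a common complement *)

Section NoCommonComplement.
Variables (R : realType) (V : completeNormedModType R[i]) (ip : V -> V -> R[i]).
Context {hip : hilbert_inner ip}.
Local Notation "<| x , y |>" := (reip ip x y).
Implicit Types (x y z t : V).

Definition half_orth (S T : set V) : set V := [set x | S x /\ orth ip T x].

(** This is the space H0; it contains the intersection of [S] and [T] and that of their
    orthocomplements, so it is larger than the usual generic part of two subspaces. *)
Definition generic_part (S T : set V) : set V :=
  [set x | orth ip (half_orth S T) x /\ orth ip (half_orth T S) x].

Lemma half_orth_subspace S T : subspace S -> subspace (half_orth S T).
Proof.
move=> hS; split; first by split; [exact: hS.1|exact: (orth_subspace _).1].
by move=> a x y [Sx ox] [Sy oy]; split; [exact: subZD|exact: (orth_subspace _).2].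
Qed.

Lemma nrm_sum (I : Type) (r : seq I) (F : I -> V) :
  nrm (\sum_(i <- r) F i) <= \sum_(i <- r) nrm (F i).
Proof.
elim: r => [|i r IH]; rewrite ?big_nil ?nrm0// !big_cons.
by apply: le_trans (nrmD _ _) _; rewrite lerD2l.
Qed.

(** [f] has one vector more than [e]. Surjectivity would give [w] in [T] with [Q (B w) = Q (f n)],
    hence [B w = f n], as [Q] is injective on [S]; but [B w] is orthogonal to [f n]. *)
Lemma fredholm_no_complement (S T : set V) (PS PT : V -> V) (n : nat) (e f : nat -> V) :
  closed_subspace S -> closed_subspace T ->
  is_orth_proj ip S PS -> is_orth_proj ip T PT -> common_complement S T ->
  totally_bounded ((fun x => PS x - PT x) @` [set x | generic_part S T x /\ nrm x <= 1]) ->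
  fin_onb ip (half_orth T S) n e ->
  (forall i, (i < n.+1)%N -> half_orth S T (f i)) ->
  (forall i j, (i < n.+1)%N -> (j < n.+1)%N -> ip (f i) (f j) = (i == j)%:R) -> False.
Proof.
move=> hS hT hPS hPT [Z [hZ SZ TZ _ spT]] tbA he fM fo.
have linPS : lin PS by exact: (proj_lin hS.1 hPS).
have linPT : lin PT by exact: (proj_lin hT.1 hPT).
have [C C0 hC] := complement_bounded hT hZ TZ spT.
have Qex x : exists t, T t /\ Z (x - t).
  by have [t [z [Tt Zz ->]]] := spT x; exists t; rewrite addrC addKr.
have [Q hQ] := choice Qex.
have Quniq x t : T t -> Z (x - t) -> Q x = t.
  move=> Tt Zt; apply/eqP; rewrite -subr_eq0; apply/eqP.
  suff : (T `&` Z) (Q x - t) by rewrite TZ.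
  split; first by apply: subB => //; [exact: hT.1|case: (hQ x)].
  have -> : Q x - t = (x - t) - (x - Q x) by rewrite opprB [RHS]addrC addrA subrK.
  by apply: subB => //; [exact: hZ.1|case: (hQ x)].
have linQ : lin Q.
  move=> a x y; have [Tx Zx] := hQ x; have [Ty Zy] := hQ y.
  apply: Quniq; first exact: (subZD _ hT.1).
  have -> : a *: x + y - (a *: Q x + Q y) = a *: (x - Q x) + (y - Q y).
    by rewrite scalerBr addrACA opprD.
  exact: (subZD _ hZ.1).
have QT t : T t -> Q t = t.
  by move=> Tt; apply: Quniq => //; rewrite subrr; exact: hZ.1.1.
have QC x : nrm (Q x) <= C * nrm x.
  have [Tx Zx] := hQ x; have := hC _ _ Tx Zx.
  by rewrite addrC subrK.
have SQ0 s : S s -> Q s = 0 -> s = 0.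
  move=> Ss Q0; have [_] := hQ s; rewrite Q0 subr0 => Zs.
  by have : (S `&` Z) s by []; rewrite SZ.
(* [F e] is the projection on T ∩ S^⊥ and [F f] follows it by the isometry [e i] to [f i], which
   leaves out [f n]. *)
pose F (v : nat -> V) x := \sum_(i < n) ip x (e i) *: v i.
have linF v : lin (F v).
  move=> a x y; rewrite /F scaler_sumr -big_split; apply: eq_bigr => i _.
  by rewrite ipDl ipZl scalerDl scalerA.
have [eM eo _] := he.
have e1 (i : 'I_n) : nrm (e i) = 1.
  have := eo i i; rewrite ltn_ord eqxx ipxx => /(_ isT isT)[] /eqP.
  by rewrite sqrf_eq1 => /orP[/eqP//|/eqP h]; have := nrm_ge0 (e i); rewrite h; lra.
have ce x (i : 'I_n) : `|ip x (e i)| <= (nrm x)%:C.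
  by have := @ip_cauchy_schwarz _ _ ip hip x (e i); rewrite e1 mulr1.
have FC v x : nrm (F v x) <= (\sum_(i < n) nrm (v i)) * nrm x.
  apply: le_trans (nrm_sum _ _) _; rewrite mulr_suml; apply: ler_sum => i _.
  rewrite nrmZ mulrC ler_wpM2l ?nrm_ge0// -lecR RRe_real ?ger0_real//.

pose B x := PS x + F f x.
have linB' : lin B.
  by move=> a x y; rewrite /B linPS linF scalerDr addrACA.
pose K x := x - Q (B x).
have linK : lin K.
  by move=> a x y; rewrite /K linB' linQ scalerBr addrACA opprD.
have fT i : (i < n.+1)%N -> orth ip T (f i) by move=> /fM[].
have fS i : (i < n.+1)%N -> S (f i) by move=> /fM[].
have BS x : S (B x).
  apply: (subD hS.1); first exact: (proj_in hPS).
  by apply: (sub_sum _ hS.1) => i; apply: (subZ _ hS.1); apply: fS; apply: leqW.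
have ipB t j : T t -> (j < n.+1)%N ->
    ip (B t) (f j) = \sum_(i < n) ip t (e i) * (i == j :> nat)%:R.
  move=> Tt jn; rewrite /B ipDl (ip_proj hPS _ (fS j jn)).
  rewrite (ip_eq0C (fT j jn t Tt)) add0r ip_suml.
  by apply: eq_bigr => i _; rewrite ipZl fo//; exact: leqW.
have [w Tw] : exists2 w, T w & w - K w = Q (f n).
  apply: (id_minus_compact_surj (K := K)
    (C := 1 + C * (1 + \sum_(i < n) nrm (f i))) (ip := ip)) => //.
  - move=> x; rewrite mulrDl mul1r; apply: le_trans (nrmB _ _) _; rewrite lerD2l.
    apply: le_trans (QC _) _; rewrite -mulrA ler_pM2l//.
    apply: le_trans (nrmD _ _) _; rewrite mulrDl mul1r lerD//.
    exact: (proj_le hPS).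
  - by move=> t Tt; apply: (subB hT.1) => //; case: (hQ (B t)).
  - have Qlip := lin_lip linQ QC.
    have Nlip x y : nrm (- x - - y) <= 1 * nrm (x - y).
      by rewrite mul1r -opprD nrmN.

    (* With [p = F e t], [K t = Q (t - B t)] and [t - B t] is minus A applied to [t - p], an element
       of H0, plus the finite-rank term with vectors [e i - f i]. *)
    apply: tbS (tb_image Qlip (tb_add (tb_image Nlip tbA)
      (tb_comb (index_enum 'I_n) (fun i : 'I_n => e i - f i)))).
    move=> _ [t [Tt t1] <-]; pose p := F e t.
    have M2p : half_orth T S p.
      have hM := half_orth_subspace S hT.1.
      by apply: (sub_sum _ hM) => i; apply: (subZ _ hM); exact: eM.
    have M2t x : half_orth T S x -> ip (t - p) x = 0.
      move=> M2x; rewrite (fin_onb_expand (half_orth_subspace S hT.1) he M2x).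
      rewrite ipC ip_suml big1 ?conjc0// => i _.
      suff te : ip (t - p) (e i) = 0 by rewrite ipZl (ip_eq0C te) mulr0.
      rewrite ipBl ip_suml (bigD1 i)//= ipZl eo// eqxx mulr1 big1 ?addr0 ?subrr//.
      move=> j ji; rewrite ipZl eo//.
      by have /negbTE -> : (j : nat) != i by []; rewrite mulr0.
    have Ttp : T (t - p) by apply: (subB hT.1) => //; case: M2p.
    exists (t - B t); last by rewrite (linB _ _ linQ) QT.
    exists (- (PS (t - p) - PT (t - p))).
      exists (PS (t - p) - PT (t - p)) => //; exists (t - p) => //; split.
        split=> x; last exact: M2t.
        by move=> [_ oT]; apply: ip_eq0C; exact: oT.
      apply: le_trans t1; apply: nrm_le_sqr; rewrite ?nrm_ge0//.
      have -> : nrm t ^+ 2 = nrm (t - p) ^+ 2 + nrm p ^+ 2.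
        by rewrite -{1}(subrK p t) (nrmD2 (t - p)) (reip0 (M2t p M2p)) mulr0 addr0.
      by rewrite lerDl sqr_ge0.
    exists (p - F f t).
      exists (fun i : 'I_n => ip t (e i)).
        by move=> i; apply: le_trans (ce _ _) _; rewrite lecR.
      by rewrite /p /F -sumrB; apply: eq_bigr => i _; rewrite scalerBr.
    rewrite (linB _ _ linPS) (linB _ _ linPT) (proj_id hT.1 hPT Tt).
    rewrite (proj_orth0 hS.1 hPS M2p.2) (proj_id hT.1 hPT M2p.1) subr0.
    rewrite opprB /B opprD !addrA; congr (_ + _).
    by rewrite [LHS]addrAC subrK.
  (* From [B t = 0], pairing with [f i] gives [ip t (e i) = 0]; then [PS t = 0], so [t] is in T ∩
     S^⊥ and orthogonal to its basis. *)
  - move=> t Tt; rewrite /K subKr => /(SQ0 _ (BS t)) B0.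
    have et (i : 'I_n) : ip t (e i) = 0.
      have := ipB t i Tt (leqW (ltn_ord i)); rewrite B0 ip0l (bigD1 i)//= eqxx mulr1.
      rewrite big1 ?addr0 => [/esym//|j ji].
      by have /negbTE -> : (j : nat) != i by []; rewrite mulr0.
    have F0 : F f t = 0 by rewrite /F big1// => i _; rewrite et scale0r.
    have oS : orth ip S t by apply: (proj_eq0 hPS); rewrite -B0 /B F0 addr0.
    have [_ _ maxe] := he; apply: maxe => // i i_n.
    exact: (et (Ordinal i_n)).
  - by case: (hQ (f n)).
rewrite /K subKr => /eqP; rewrite -subr_eq0 -(linB _ _ linQ) => /eqP h.
have /eqP : B w - f n = 0 by apply: SQ0 => //; apply: (subB hS.1) => //; exact: fS.
rewrite subr_eq0 => /eqP Bw; have := ipB w n Tw (ltnSn n).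
rewrite Bw fo// eqxx big1 => [/eqP|i _]; first by rewrite oner_eq0.
by rewrite ltn_eqF// mulr0.
Qed.

End NoCommonComplement.

(** * Two projections *)

Section SpanRelation.
Variables (R : realType) (V : completeNormedModType R[i]) (ip : V -> V -> R[i]).
Context {hip : hilbert_inner ip}.
Implicit Types (x y z t s : V).

(** The span of the pairs [(e i, f i)]; being a relation, it requires no check that the image is
    independent of the chosen combination. *)
Inductive span_rel (I : Type) (e f : I -> V) : V -> V -> Prop :=
| span_rel0 : span_rel e f 0 0
| span_relS c i t s : span_rel e f t s -> span_rel e f (c *: e i + t) (c *: f i + s).

Lemma span_rel_linrel (I : Type) (e f : I -> V) : linrel (span_rel e f).
Proof.
split=> [|a t s t' s' h h']; first exact: span_rel0.
elim: h => [|c i {}t {}s _ IH]; first by rewrite !scaler0 !add0r.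
by rewrite !scalerDr !scalerA -!addrA; exact: span_relS.
Qed.

Lemma span_rel_gen (I : Type) (e f : I -> V) i : span_rel e f (e i) (f i).
Proof.
by rewrite -[e i]scale1r -[f i]scale1r -[1 *: e i]addr0 -[1 *: f i]addr0;
  apply: span_relS; exact: span_rel0.
Qed.

Lemma span_rel_in (I : Type) (e f : I -> V) (M N : set V) t s :
  subspace M -> subspace N -> (forall i, M (e i)) -> (forall i, N (f i)) ->
  span_rel e f t s -> M t /\ N s.
Proof.
move=> hM hN eM fN; elim=> [|c i {}t {}s _ [IH1 IH2]]; first by split; [case: hM|case: hN].
by split; exact: subZD.
Qed.

Lemma span_rel_isometry (I : Type) (e f : I -> V) t s t' s' :
  (forall i j, ip (e i) (e j) = ip (f i) (f j)) ->
  span_rel e f t s -> span_rel e f t' s' -> ip t t' = ip s s'.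
Proof.
move=> ef h h'; elim: h => [|c i {}t {}s _ IH]; first by rewrite !ip0l.
rewrite !ipDl !ipZl IH; congr (_ * _ + _).
elim: h' => [|c' j u v _ IH']; first by rewrite !ip0r.
by rewrite !ipDr !ipZr ef IH'.
Qed.

Lemma onb_gram (M N : set V) (I : Type) (e f : I -> V) :
  orthonormal_basis ip M e -> orthonormal_basis ip N f ->
  forall i j, ip (e i) (e j) = ip (f i) (f j).
Proof.
move=> [_ e1 eo _] [_ f1 fo _] i j.
have [->|ij] := pselect (i = j); first by rewrite e1 f1.
by rewrite eo// fo.
Qed.

(** Testing against all vectors turns identities between products of projections into scalar ones
    that [ring] decides. *)
Lemma ext_reip x y : (forall w, reip ip x w = reip ip y w) -> x = y.
Proof.
move=> h; apply/eqP; rewrite -subr_eq0; apply/eqP/nrm_eq0/eqP.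
by rewrite -sqrf_eq0 -reipE reipDl reipNl h subrr.
Qed.

Lemma nrm_sqr_eq0 x : nrm x ^+ 2 = 0 -> x = 0.
Proof. by move=> /eqP; rewrite sqrf_eq0 => /eqP/nrm_eq0. Qed.

End SpanRelation.

Section TwoProjections.
Variables (R : realType) (V : completeNormedModType R[i]) (ip : V -> V -> R[i]).
Context {hip : hilbert_inner ip}.
Local Notation "<| x , y |>" := (reip ip x y).
Implicit Types (x y z t s u : V).
Variables (S T : set V) (PS PT : V -> V).
Hypotheses (hS : closed_subspace S) (hT : closed_subspace T)
  (hPS : is_orth_proj ip S PS) (hPT : is_orth_proj ip T PT).

Let linPS : lin PS. Proof. exact: (proj_lin hS.1 hPS). Qed.
Let linPT : lin PT. Proof. exact: (proj_lin hT.1 hPT). Qed.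
Let PSPS x : PS (PS x) = PS x.
Proof. exact: (proj_id hS.1 hPS (proj_in hPS x)). Qed.
Let PTPT x : PT (PT x) = PT x.
Proof. exact: (proj_id hT.1 hPT (proj_in hPT x)). Qed.

Definition proj_diff x := PS x - PT x.
Definition proj_cosum x := PS x + PT x - x.
Local Notation A := proj_diff.
Local Notation B := proj_cosum.

Let linE := (fun x y => linD x y linPS, fun x => linN x linPS,
  fun x y => linD x y linPT, fun x => linN x linPT, PSPS, PTPT).

Lemma proj_diff_lin : lin A.
Proof. by move=> a x y; rewrite /A linPS linPT scalerBr addrACA opprD. Qed.

Lemma proj_cosum_lin : lin B.
Proof.
move=> a x y; rewrite /B linPS linPT scalerBr scalerDr !opprD [RHS]addrACA.
by congr (_ + _); rewrite addrACA.
Qed.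

Lemma proj_diff_sa : selfadj ip A.
Proof. by move=> x y; rewrite /A !reipD (proj_rsa hPS) (proj_rsa hPT). Qed.

Lemma proj_cosum_sa : selfadj ip B.
Proof. by move=> x y; rewrite /B !reipD (proj_rsa hPS) (proj_rsa hPT). Qed.

Lemma proj_cosum_sqr x : B (B x) = x - A (A x).
Proof.
by apply: (@ext_reip _ _ ip hip) => w; rewrite /A /B !linE !reipD; ring.
Qed.

(** Both sides equal [P_S - P_S P_T P_S]; A itself does not commute with [P_S] in general. *)
Lemma proj_diff_sqr_comS x : PS (A (A x)) = A (A (PS x)).
Proof.
by apply: (@ext_reip _ _ ip hip) => w; rewrite /A !linE !reipD; ring.
Qed.

Lemma proj_diff_sqr_comT x : PT (A (A x)) = A (A (PT x)).
Proof.
by apply: (@ext_reip _ _ ip hip) => w; rewrite /A !linE !reipD; ring.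
Qed.

Lemma proj_pyth2 x : nrm x ^+ 2 = nrm (A x) ^+ 2 + nrm (B x) ^+ 2.
Proof.
rewrite -!reipE (proj_diff_sa x (A x)) (proj_cosum_sa x (B x)) proj_cosum_sqr.
by rewrite reipDr reipNr; ring.
Qed.

Lemma proj_diff_le x : nrm (A x) <= nrm x.
Proof. by apply: nrm_le_sqr; rewrite ?nrm_ge0// (proj_pyth2 x) lerDl sqr_ge0. Qed.

Lemma proj_cosum_le x : nrm (B x) <= nrm x.
Proof. by apply: nrm_le_sqr; rewrite ?nrm_ge0// (proj_pyth2 x) lerDr sqr_ge0. Qed.

Lemma proj_cosum_T x : T x -> B x = PS x.
Proof. by move=> Tx; rewrite /B (proj_id hT.1 hPT Tx) addrK. Qed.

(* For [u] in T, [B u = P_S u], so the polar decomposition of B pairs |B| u with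
   P_S u isometrically; it is complemented by the given pairing of
   T ∩ S^⊥ with S ∩ T^⊥. *)
Lemma same_hdim_common_complement :
  same_hdim ip (half_orth ip S T) (half_orth ip T S) -> common_complement S T.
Proof.
move=> [I [e [f [he hf]]]].
have [Y [linY saY Y0 YY Ycom]] :=
  @abs_op_ex _ _ ip hip B proj_cosum_lin proj_cosum_sa proj_cosum_le.
have bound1 P M : is_orth_proj ip M P -> forall x, nrm (P x) <= 1 * nrm x.
  by move=> hP x; rewrite mul1r; exact: (proj_le hP).
have YS x : PS (Y x) = Y (PS x).
  apply: (Ycom PS 1) => //; first exact: bound1 hPS.
  by move=> y; rewrite !proj_cosum_sqr (linB _ _ linPS) proj_diff_sqr_comS.
have YT x : PT (Y x) = Y (PT x).
  apply: (Ycom PT 1) => //; first exact: bound1 hPT.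
  by move=> y; rewrite !proj_cosum_sqr (linB _ _ linPT) proj_diff_sqr_comT.
have TY u : T u -> T (Y u).
  by move=> Tu; rewrite -(proj_id hT.1 hPT Tu) -YT; exact: (proj_in hPT).
have nY x : nrm (Y x) ^+ 2 = nrm (B x) ^+ 2.
  by rewrite -!reipE saY YY -proj_cosum_sa.
pose G t s := exists t1 s1 u,
  [/\ span_rel f e t1 s1, T u, t = t1 + Y u & s = s1 + PS u].
have [eM e1 eo emax] := he; have [fM f1 fo fmax] := hf.
have sS : subspace (half_orth ip S T) by exact: half_orth_subspace hS.1.
have sT : subspace (half_orth ip T S) by exact: half_orth_subspace hT.1.
have span_in t s : span_rel f e t s -> half_orth ip T S t /\ half_orth ip S T s.
  exact: (span_rel_in sT sS fM eM).
have hG : linrel G.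
  split.
    exists 0, 0, 0; split; [exact: span_rel0|exact: hT.1.1|..].
      by rewrite lin0// addr0.
    by rewrite lin0// addr0.
  move=> a _ _ _ _ [t [s [u [ts Tu -> ->]]]] [t' [s' [u' [ts' Tu' -> ->]]]].
  exists (a *: t + t'), (a *: s + s'), (a *: u + u'); split.
  - exact: (span_rel_linrel f e).2.
  - exact: (subZD _ hT.1).
  - by rewrite linY scalerDr addrACA.
  - by rewrite linPS scalerDr addrACA.
(* All cross terms vanish and [<Y u, PS u> = <Y (PS u), PS u> >= 0]; equal norms and a nonnegative
   product allow both constants to be 1. *)
have key t1 s1 u : span_rel f e t1 s1 -> T u -> [/\ nrm (t1 + Y u) = nrm (s1 + PS u)
    & 0 <= <|t1 + Y u, s1 + PS u|>].
  move=> ts Tu; have [[Tt oSt] [Ss oTs]] := span_in _ _ ts.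
  have iso : nrm t1 ^+ 2 = nrm s1 ^+ 2.
    rewrite -!reipE /reip; congr (complex.Re _).
    by apply: (span_rel_isometry _ ts ts); exact: onb_gram hf he.
  have Yt : Y t1 = 0.
    apply: nrm_sqr_eq0; rewrite nY proj_cosum_T// (proj_orth0 hS.1 hPS)//.
    by rewrite nrm0 expr0n.
  split.
    apply/eqP; rewrite -(@eqrXn2 _ 2) ?nrm_ge0//; apply/eqP.
    rewrite !nrmD2 iso nY proj_cosum_T// -saY Yt reip0l.
    by rewrite -(proj_rsa hPS) (proj_id hS.1 hPS Ss) (reip0 (oTs _ Tu)).
  rewrite !reipDl !reipDr; have -> : <|t1, s1|> = 0.
    by rewrite reipC (reip0 (oTs _ Tt)).
  have -> : <|t1, PS u|> = 0 by rewrite (reip0 (oSt _ (proj_in hPS u))).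
  have -> : <|Y u, s1|> = 0 by rewrite reipC (reip0 (oTs _ (TY _ Tu))).
  rewrite !add0r -(reip_proj hPS) ?YS//; exact: (proj_in hPS).
apply: (@relation_common_complement _ _ ip hip S T G 1 1) => //.
- move=> _ _ [t [s [u [ts Tu -> ->]]]]; have [[Tt _] [Ss _]] := span_in _ _ ts.
  by split; apply: subD => //; [exact: hT.1|exact: TY|exact: hS.1|exact: (proj_in hPS)].
(* The pair with [u = Y x] gives [|Y x| = 0], hence [PS x = 0]; so [x] is in T ∩ S^⊥, where the
   basis [f] finishes. *)
- move=> x Tx ox; have GY u : T u -> G (Y u) (PS u).
    by move=> Tu; exists 0, 0, u; rewrite !add0r; split=> //; exact: span_rel0.
  have Yx : Y x = 0.
    apply: nrm_sqr_eq0; rewrite -reipE saY.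
    by rewrite (reip0 (ox _ _ (GY _ (TY _ Tx)))).
  apply: fmax; last first.
    move=> i; apply: (ox _ (e i)); exists (f i), (e i), 0; split.
    + exact: span_rel_gen.
    + exact: hT.1.1.
    + by rewrite lin0// addr0.
    + by rewrite lin0// addr0.
  split=> //; apply: (proj_eq0 hPS); rewrite -proj_cosum_T//.
  by apply: nrm_sqr_eq0; rewrite -nY Yx nrm0 expr0n.
- move=> x Sx ox; apply: emax; last first.
    move=> i; apply: (ox (f i)); exists (f i), (e i), 0; split.
    + exact: span_rel_gen.
    + exact: hT.1.1.
    + by rewrite lin0// addr0.
    + by rewrite lin0// addr0.
  split=> // u Tu; rewrite -(proj_id hS.1 hPS Sx) (proj_sa hPS).
  apply: (ox (Y u)); exists 0, 0, u; rewrite !add0r; split=> //; exact: span_rel0.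
- move=> _ _ [t [s [u [ts Tu -> ->]]]]; have [_ h] := key _ _ _ ts Tu.
  by rewrite mul1r reipDr reipE lerDl.
- move=> _ _ [t [s [u [ts Tu -> ->]]]]; have [_ h] := key _ _ _ ts Tu.
  by rewrite mul1r [X in _ <= X]reipDr reipE lerDr reipC.
- by move=> _ _ [t [s [u [ts Tu -> ->]]]]; have [-> _] := key _ _ _ ts Tu; rewrite mul1r.
- by move=> _ _ [t [s [u [ts Tu -> ->]]]]; have [-> _] := key _ _ _ ts Tu; rewrite mul1r.
Qed.

End TwoProjections.

(** * Cutting along the spectrum of A^2 *)

Section SpectralCut.
Variables (R : realType) (V : completeNormedModType R[i]) (ip : V -> V -> R[i]).
Context {hip : hilbert_inner ip}.
Local Notation "<| x , y |>" := (reip ip x y).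
Implicit Types (x y z t s u : V).

(** A self-adjoint operator that preserves [E] also preserves its orthocomplement. *)
Lemma proj_commute (E : set V) (Q P : V -> V) : closed_subspace E ->
  is_orth_proj ip E Q -> lin P -> (forall x y, ip (P x) y = ip x (P y)) ->
  (forall x, E x -> E (P x)) -> forall x, Q (P x) = P (Q x).
Proof.
move=> hE hQ linP saP EP x; apply: (proj_uniq hE.1 hQ); first exact/EP/(proj_in hQ).
by rewrite -linB// => y Ey; rewrite saP; apply: (hQ x).2; exact: EP.
Qed.

Variables (S T : set V) (PS PT : V -> V).
Hypotheses (hS : closed_subspace S) (hT : closed_subspace T)
  (hPS : is_orth_proj ip S PS) (hPT : is_orth_proj ip T PT).
Local Notation A := (proj_diff PS PT).

Let linPS : lin PS. Proof. exact: (proj_lin hS.1 hPS). Qed.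
Let linPT : lin PT. Proof. exact: (proj_lin hT.1 hPT). Qed.
Let linA : lin A. Proof. exact: (proj_diff_lin hS hT hPS hPT). Qed.
Let saA : selfadj ip A. Proof. exact: proj_diff_sa. Qed.
Let A1 x : nrm (A x) <= nrm x. Proof. exact: (proj_diff_le hS hT hPS hPT). Qed.

(* With Y the absolute value of X = (A^2 - a) / 2, the range of Y + X lies in
   ker (Y - X), so that X >= 0 on that kernel and X <= 0 on its complement. *)
Lemma spectral_cut (a : R) : 0 < a -> a < 1 -> exists E Q,
  [/\ closed_subspace E, is_orth_proj ip E Q,
      (forall x, Q (PS x) = PS (Q x)) /\ (forall x, Q (PT x) = PT (Q x)),
      forall x, E x -> a * nrm x ^+ 2 <= nrm (A x) ^+ 2 &
      forall x, Q x = 0 -> nrm (A x) ^+ 2 <= a * nrm x ^+ 2].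
Proof.
(* The factor 1/2 keeps the norm of [X] at most 1, as [abs_op_ex] requires. *)
move=> a0 a1; pose X x := (2^-1)%:C *: (A (A x) - a%:C *: x).
have linX : lin X.
  have sC (b c : R[i]) z : b *: (c *: z) = c *: (b *: z) by rewrite !scalerA mulrC.
  move=> c x y; rewrite /X !linA (sC c) -[RHS]scalerDr; congr (_ *: _).
  by rewrite [a%:C *: (_ + _)]scalerDr (sC a%:C) opprD addrACA -scalerBr.
have saX : selfadj ip X.
  move=> x y; rewrite /X reipZl reipZr [in LHS]reipDl [in RHS]reipDr reipNl reipNr.
  by rewrite reipZl reipZr !saA.
have X1 x : nrm (X x) <= nrm x.
  rewrite nrmZr ger0_norm ?invr_ge0//.
  have := nrmB (A (A x)) (a%:C *: x); rewrite nrmZr (gtr0_norm a0).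
  have := le_trans (A1 (A x)) (A1 x); have := ler_wpM2r (nrm_ge0 x) (ltW a1).
  lra.
have [Y [linY saY Y0 YY Ycom]] := @abs_op_ex _ _ ip hip X linX saX X1.
have nXA x : <|X x, x|> = (nrm (A x) ^+ 2 - a * nrm x ^+ 2) / 2.
  by rewrite /X reipZl reipDl reipNl reipZl saA !reipE; field.
have Y1 x : nrm (Y x) <= nrm x.
  apply: le_trans (X1 x); apply: nrm_le_sqr; rewrite ?nrm_ge0//.
  by rewrite -!reipE saY YY -saX.
have XY x : X (Y x) = Y (X x) by apply: (Ycom X 1) => // y; rewrite mul1r.
pose E := [set x | Y x = X x].
have hE : closed_subspace E.
  split.
    split; first by rewrite /E /mkset !lin0.
    by move=> c x y Ex Ey; rewrite /E /mkset linY linX Ex Ey.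
  apply/closedP => x ax; apply: (@eq_lim _ _ _ _ 2) => e e0.
  have [y Ey xy] := ax e e0; have -> : Y x - X x = Y (x - y) - X (x - y).
    by rewrite (linB _ _ linY) (linB _ _ linX) Ey opprB addrA subrK.
  apply: le_trans (nrmB _ _) _; have := Y1 (x - y); have := X1 (x - y).
  by have := ltW xy; lra.
have [Q hQ] := proj_ex hE.
have X_com P : lin P -> (forall x, P (A (A x)) = A (A (P x))) -> forall x, P (X x) = X (P x).
  by move=> linP PA x; rewrite /X linZ// linB// linZ// PA.
have E_com P M : is_orth_proj ip M P -> subspace M ->
    (forall x, P (A (A x)) = A (A (P x))) -> forall x, E x -> E (P x).
  move=> hP hM PA x Ex; have linP : lin P by exact: (proj_lin hM hP).
  have PX := X_com P linP PA.
  rewrite /E /mkset -PX -Ex; apply/esym/(Ycom P 1) => // y.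
    by rewrite mul1r; exact: (proj_le hP).
  by rewrite !PX.
exists E, Q; split => //.
- split.
    apply: (proj_commute hE hQ linPS (proj_sa hPS)); apply: (E_com _ _ hPS hS.1) => x.
    exact: (proj_diff_sqr_comS hS hT hPS hPT).
  apply: (proj_commute hE hQ linPT (proj_sa hPT)); apply: (E_com _ _ hPT hT.1) => x.
  exact: (proj_diff_sqr_comT hS hT hPS hPT).
- by move=> x Ex; have := Y0 x; rewrite Ex nXA; lra.
- move=> x Qx; have oE := proj_eq0 hQ Qx.
  (* [Y] and [X] commute and have the same square, so [(Y - X) (Y + X) = 0]. *)
  have YX0 : Y x + X x = 0.
    apply: (@ext_reip _ _ ip hip) => w; rewrite reip0l reipDl saY saX -reipDr.
    apply: reip0; apply: oE; rewrite /E /mkset linD// [in RHS]linD// YY XY.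
    by rewrite addrC.
  have := Y0 x; have -> : Y x = - X x by apply/eqP; rewrite -addr_eq0 YX0.
  by rewrite reipNl nXA; lra.
Qed.

Section Cut.
Variables (a : R) (E : set V) (Q : V -> V).
Hypotheses (a0 : 0 < a) (a1 : a < 1) (hE : closed_subspace E) (hQ : is_orth_proj ip E Q)
  (QS : forall x, Q (PS x) = PS (Q x)) (QT : forall x, Q (PT x) = PT (Q x))
  (Ege : forall x, E x -> a * nrm x ^+ 2 <= nrm (A x) ^+ 2)
  (Ele : forall x, Q x = 0 -> nrm (A x) ^+ 2 <= a * nrm x ^+ 2).

Let linQ : lin Q. Proof. exact: (proj_lin hE.1 hQ). Qed.

Let AT t : T t -> nrm t ^+ 2 = nrm (PS t) ^+ 2 + nrm (A t) ^+ 2.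
Proof.
by move=> Tt; rewrite (proj_pyth hPS t) /A (proj_id hT.1 hPT Tt) nrmBC.
Qed.

(** On [E] any isometric pairing leaves a margin [a / 2] in the product; off [E],
    [|PS u|^2 >= (1 - a) |u|^2], which accounts for the constant [(1 - a)^-1]. The two parts are
    orthogonal. *)
Lemma cut_common_complement (e f : nat -> V) :
  orthonormal_basis ip (T `&` E) e -> orthonormal_basis ip (S `&` E) f ->
  common_complement S T.
Proof.
move: (a0) (a1) => a0' a1' he hf; have [eM _ _ emax] := he; have [fM _ _ fmax] := hf.
pose G t s := exists t1 s1 u,
  [/\ span_rel e f t1 s1, T u /\ Q u = 0, t = t1 + u & s = s1 + PS u].
have sI (M : set V) : closed_subspace M -> subspace (M `&` E).
  move=> hM; split; first by split; [exact: hM.1.1|exact: hE.1.1].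
  by move=> c x y [? ?] [? ?]; split; [exact: (subZD _ hM.1)|exact: (subZD _ hE.1)].
have span_in t s : span_rel e f t s -> (T `&` E) t /\ (S `&` E) s.
  exact: (span_rel_in (sI _ hT) (sI _ hS) eM fM).
have oE x y : E x -> Q y = 0 -> <|x, y|> = 0.
  by move=> Ex Qy; rewrite reipC (reip0 (proj_eq0 hQ Qy Ex)).
have hG : linrel G.
  split.
    exists 0, 0, 0; split; [exact: span_rel0| |by rewrite addr0|by rewrite lin0// addr0].
    by split; [exact: hT.1.1|exact: lin0].
  move=> c _ _ _ _ [t [s [u [ts [Tu Qu] -> ->]]]] [t' [s' [u' [ts' [Tu' Qu'] -> ->]]]].
  exists (c *: t + t'), (c *: s + s'), (c *: u + u'); split.
  - exact: (span_rel_linrel e f).2.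
  - by split; [exact: (subZD _ hT.1)|rewrite linQ Qu Qu' scaler0 addr0].
  - by rewrite scalerDr addrACA.
  - by rewrite linPS scalerDr addrACA.
have key t1 s1 u : span_rel e f t1 s1 -> T u -> Q u = 0 -> [/\
    nrm (t1 + u) ^+ 2 = nrm t1 ^+ 2 + nrm u ^+ 2,
    nrm (s1 + PS u) ^+ 2 = nrm t1 ^+ 2 + nrm (PS u) ^+ 2,
    - (1 - a / 2) * nrm t1 ^+ 2 + nrm (PS u) ^+ 2 <= <|t1 + u, s1 + PS u|>,
    nrm (PS u) ^+ 2 <= nrm u ^+ 2 & (1 - a) * nrm u ^+ 2 <= nrm (PS u) ^+ 2].
  move=> ts Tu Qu; have [[Tt Et] [Ss Es]] := span_in _ _ ts.
  have iso : nrm t1 ^+ 2 = nrm s1 ^+ 2.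
    rewrite -!reipE /reip; congr (complex.Re _).
    by apply: (span_rel_isometry _ ts ts); exact: onb_gram he hf.
  have QPu : Q (PS u) = 0 by rewrite QS Qu lin0.
  split.
  - by rewrite nrmD2 oE// mulr0 addr0.
  - by rewrite nrmD2 oE// mulr0 addr0 iso.
  - rewrite !reipDl !reipDr (oE t1 (PS u))// [<|u, s1|>]reipC (oE s1 u)//.
    rewrite [<|u, PS u|>]reipC (reip_proj_self hPS).
    have -> : <|t1, s1|> = <|PS t1, s1|> by rewrite (reip_proj hPS).
    have := @abs_cauchy_schwarz _ _ ip hip (PS t1) s1.
    have -> : nrm s1 = nrm t1.
      by apply/eqP; rewrite -(@eqrXn2 _ 2) ?nrm_ge0// iso.
    (* [|PS t1|^2 <= (1 - a) |t1|^2] on [E], and [1 - a <= (1 - a / 2)^2]. *)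
    have : nrm (PS t1) <= (1 - a / 2) * nrm t1.
      apply: nrm_le_sqr; first by rewrite mulr_ge0 ?nrm_ge0//; lra.
      rewrite exprMn; have := AT Tt; have := Ege Et.
      have : 0 <= a ^+ 2 * nrm t1 ^+ 2 by rewrite mulr_ge0 ?sqr_ge0.
      by set r := nrm t1 ^+ 2; lra.
    rewrite ler_norml => h /andP[h' _].
    have := ler_wpM2r (nrm_ge0 t1) h; rewrite -mulrA -expr2; lra.
  - by rewrite ler_sqr ?nnegrE ?nrm_ge0// (proj_le hPS).
  - by have := AT Tu; have := Ele Qu; lra.
have M0 : 0 < (1 - a)^-1 by rewrite invr_gt0; lra.
apply: (@relation_common_complement _ _ ip hip S T G (a / 2) (1 - a)^-1) => //.
- by rewrite divr_gt0.
- move=> _ _ [t [s [u [ts [Tu _] -> ->]]]]; have [[Tt _] [Ss _]] := span_in _ _ ts.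
  by split; apply: subD => //; [exact: hT.1|exact: hS.1|exact: (proj_in hPS)].
(* The pair built from [u = x - Q x] puts [x] in [E]; the basis [e] then gives [x = 0]. *)
- move=> x Tx ox; have Q0 : Q (x - Q x) = 0.
    by rewrite linB// (proj_id hE.1 hQ (proj_in hQ x)) subrr.
  have TQ : T (Q x) by rewrite -(proj_id hT.1 hPT Tx) QT; exact: (proj_in hPT).
  have Ex : E x.
    have x0 : x - Q x = 0; last first.
      by move/eqP : x0; rewrite subr_eq0 => /eqP ->; exact: (proj_in hQ).
    apply: (@nrm_sqr_eq0 _ _); rewrite -reipE reipDl reipNl (oE (Q x) (x - Q x))//; last first.
      exact: (proj_in hQ).
    rewrite subr0; apply: reip0; apply: (ox _ (PS (x - Q x))).
    exists 0, 0, (x - Q x); rewrite !add0r; split=> //; first exact: span_rel0.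
    by split=> //; apply: (subB hT.1).
  apply: emax => // i; apply: (ox _ (f i)); exists (e i), (f i), 0.
  by split; [exact: span_rel_gen|split; [exact: hT.1.1|exact: lin0]|
    rewrite addr0|rewrite lin0// addr0].
- move=> x Sx ox.
  have SQ : S (Q x) by rewrite -(proj_id hS.1 hPS Sx) QS; exact: (proj_in hPS).
  have of_ i : ip x (f i) = 0.
    apply: (ox (e i)); exists (e i), (f i), 0.
    by split; [exact: span_rel_gen|split; [exact: hT.1.1|exact: lin0]|
      rewrite addr0|rewrite lin0// addr0].
  have Qx0 : Q x = 0.
    apply: fmax; first by split=> //; exact: (proj_in hQ).
    by move=> i; rewrite (ip_proj hQ)//; case: (fM i).
  have oT : orth ip T x.
    move=> u Tu; have -> : u = Q u + (u - Q u) by rewrite addrC subrK.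
    rewrite ipDr (proj_eq0 hQ Qx0 (proj_in hQ u)) add0r.
    rewrite -(proj_id hS.1 hPS Sx) (proj_sa hPS); apply: (ox (u - Q u)).
    exists 0, 0, (u - Q u); rewrite !add0r; split=> //; first exact: span_rel0.
    split; last by rewrite linB// (proj_id hE.1 hQ (proj_in hQ u)) subrr.
    by apply: (subB hT.1) => //; rewrite -(proj_id hT.1 hPT Tu) QT; exact: (proj_in hPT).
  (* Here [x] is in S ∩ T^⊥, so [A x = x], which off [E] is compatible with [a < 1] only for
     [x = 0]. *)
  apply: (@nrm_sqr_eq0 _ _); have := Ele Qx0.
  rewrite /A (proj_id hS.1 hPS Sx) (proj_orth0 hT.1 hPT oT) subr0.
  by have := sqr_ge0 (nrm x); nra.
- move=> _ _ [t [s [u [ts [Tu Qu] -> ->]]]]; have [e1 _ e3 _ _] := key _ _ _ ts Tu Qu.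
  rewrite reipDr reipE e1; have := sqr_ge0 (nrm t); have := sqr_ge0 (nrm u).
  by have := sqr_ge0 (nrm (PS u)); nra.
- move=> _ _ [t [s [u [ts [Tu Qu] -> ->]]]]; have [_ e2 e3 _ _] := key _ _ _ ts Tu Qu.
  rewrite [X in _ <= X]reipDr reipE [<|s + _, _|>]reipC e2.
  by have := sqr_ge0 (nrm t); have := sqr_ge0 (nrm (PS u)); nra.
- move=> _ _ [t [s [u [ts [Tu Qu] -> ->]]]]; have [e1 e2 _ e4 _] := key _ _ _ ts Tu Qu.
  apply: (@le_trans _ _ (nrm (t + u))).
    by apply: nrm_le_sqr; rewrite ?nrm_ge0// e1 e2 lerD2l.
  by rewrite ler_peMl ?nrm_ge0// invf_ge1; lra.
- move=> _ _ [t [s [u [ts [Tu Qu] -> ->]]]]; have [e1 e2 _ _ e5] := key _ _ _ ts Tu Qu.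
  have b0 : 0 < 1 - a by lra.
  apply: nrm_le_sqr; first by rewrite mulr_ge0 ?nrm_ge0// ltW.
  rewrite exprMn exprVn ler_pdivlMl ?exprn_gt0// e1 e2.
  by have := sqr_ge0 (nrm t); have := sqr_ge0 (nrm u); nra.
Qed.

(** [PT] maps the part of [S] inside [E] and H0 injectively into T ∩ E: its kernel there lies both
    in S ∩ T^⊥ and in the orthocomplement of that space. *)
Lemma cut_fin_onb n e : separable_space V -> fin_onb ip (T `&` E) n e ->
  (exists n' e', fin_onb ip (T `&` (E `&` generic_part ip S T)) n' e') /\
  (exists n' e', fin_onb ip (S `&` (E `&` generic_part ip S T)) n' e').
Proof.
move=> hsep he.
have sG : subspace (generic_part ip S T).
  split; first by split; exact: (orth_subspace _).1.
  by move=> c x y [? ?] [? ?]; split; exact: (orth_subspace _).2.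
have sI (M N : set V) : subspace M -> subspace N -> subspace (M `&` N).
  move=> hM hN; split; first by split; [exact: hM.1|exact: hN.1].
  by move=> c x y [? ?] [? ?]; split; exact: subZD.
have sT := sI _ _ hT.1 hE.1; have sEG := sI _ _ hE.1 sG.
split.
  apply: (fin_onb_inj (L := id) hsep sT (sI _ _ hT.1 sEG) he) => //.
  by move=> x [? [? ?]]; split.
apply: (fin_onb_inj (L := PT) hsep sT (sI _ _ hS.1 sEG) he) => //.
  move=> x [_ [Ex _]]; split; first exact: (proj_in hPT).
  by rewrite -(proj_id hE.1 hQ Ex) -QT; exact: (proj_in hQ).
move=> x [Sx [_ [xo _]]] PTx; have oT := proj_eq0 hPT PTx.
exact: (@orth_self0 _ _ ip _ (half_orth ip S T)).
Qed.

(** [Q] preserves S ∩ T^⊥ and T ∩ S^⊥, on which each of [PS] and [PT] is the identity or zero; by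
    self-adjointness H0 is preserved too. *)
Lemma cut_generic x : generic_part ip S T x ->
  (S `&` (E `&` generic_part ip S T)) (PS (Q x)) /\
  (T `&` (E `&` generic_part ip S T)) (PT (Q x)).
Proof.
move=> [h1 h2].
have Q1 y : half_orth ip S T y -> half_orth ip S T (Q y).
  move=> [Sy oy]; split; first by rewrite -(proj_id hS.1 hPS Sy) QS; exact: (proj_in hPS).
  by apply: (proj_eq0 hPT); rewrite -QT (proj_orth0 hT.1 hPT oy) lin0.
have Q2 y : half_orth ip T S y -> half_orth ip T S (Q y).
  move=> [Ty oy]; split; first by rewrite -(proj_id hT.1 hPT Ty) QT; exact: (proj_in hPT).
  by apply: (proj_eq0 hPS); rewrite -QS (proj_orth0 hS.1 hPS oy) lin0.
split; (split; [exact: (proj_in hPS) || exact: (proj_in hPT)|split]).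
- by rewrite -QS; exact: (proj_in hQ).
- split=> y hy; rewrite (proj_sa hPS).
    by rewrite (proj_id hS.1 hPS hy.1) (proj_sa hQ); apply: h1; exact: Q1.
  by rewrite (proj_orth0 hS.1 hPS hy.2) ip0r.
- by rewrite -QT; exact: (proj_in hQ).
- split=> y hy; rewrite (proj_sa hPT).
    by rewrite (proj_orth0 hT.1 hPT hy.2) ip0r.
  by rewrite (proj_id hT.1 hPT hy.1) (proj_sa hQ); apply: h2; exact: Q2.
Qed.

End Cut.
End SpectralCut.

(** * The characterization *)

Section Characterization.
Variables (R : realType) (V : completeNormedModType R[i]) (ip : V -> V -> R[i]).
Context {hip : hilbert_inner ip}.
Local Notation "<| x , y |>" := (reip ip x y).
Implicit Types (x y z : V) (S T : set V) (PS PT : V -> V).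

(** [<A x, x> = |PS x|^2 - |PT x|^2] can reach [|x|^2 = |PS x|^2 + |x - PS x|^2] only if
    [PT x = 0]. *)
Lemma eigspace1 S T PS PT : closed_subspace S -> closed_subspace T ->
  is_orth_proj ip S PS -> is_orth_proj ip T PT ->
  eigspace (fun x => PS x - PT x) 1 = half_orth ip S T.
Proof.
move=> hS hT hPS hPT; apply/seteqP; split=> x; rewrite /eigspace /mkset scale1r; last first.
  by move=> [Sx ox]; rewrite (proj_id hS.1 hPS Sx) (proj_orth0 hT.1 hPT ox) subr0.
move=> Ax; have : <|PS x - PT x, x|> = nrm x ^+ 2 by rewrite Ax reipE.
rewrite reipDl reipNl (reip_proj_self hPS) (reip_proj_self hPT) (proj_pyth hPS x) => h.
have PTx : PT x = 0.
  by apply: nrm_sqr_eq0; have := sqr_ge0 (nrm (PT x)); have := sqr_ge0 (nrm (x - PS x)); lra.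
split; last exact: (proj_eq0 hPT PTx).
by rewrite -Ax PTx subr0; exact: (proj_in hPS).
Qed.

Lemma eigspaceN1 S T PS PT : closed_subspace S -> closed_subspace T ->
  is_orth_proj ip S PS -> is_orth_proj ip T PT ->
  eigspace (fun x => PS x - PT x) (-1) = half_orth ip T S.
Proof.
move=> hS hT hPS hPT; rewrite -(eigspace1 hT hS hPT hPS); apply/seteqP.
rewrite /eigspace; split=> x; rewrite /mkset scaleN1r scale1r.
  by rewrite -[PS x - PT x]opprB => /oppr_inj.
by move=> h; rewrite -[in RHS]h opprB.
Qed.

Lemma orth_setsum (M N : set V) : M 0 -> N 0 ->
  orth ip (setsum M N) = [set x | orth ip M x /\ orth ip N x].
Proof.
move=> M0 N0; apply/seteqP; split=> x.
  move=> ox; split=> y hy; apply: ox.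
    by exists y => //; exists 0 => //; rewrite addr0.
  by exists 0 => //; exists y => //; rewrite add0r.
by move=> [hM hN] _ [y My [z Nz <-]]; rewrite ipDr hM// hN// addr0.
Qed.

Lemma generic_partC S T : generic_part ip T S = generic_part ip S T.
Proof. by apply/seteqP; split=> x [? ?]; split. Qed.

Lemma common_complementC S T : common_complement S T -> common_complement T S.
Proof. by move=> [Z [? ? ? ? ?]]; exists Z; split. Qed.

Lemma tb_opp (X : set V) : totally_bounded X -> totally_bounded [set - x | x in X].
Proof. by apply: (tb_image (C := 1)) => x y; rewrite mul1r -opprD nrmN. Qed.

Lemma fin_onb_basis (M : set V) n e : fin_onb ip M n e ->
  orthonormal_basis ip M (fun i : 'I_n => e i).
Proof.
move=> [eM eo emax]; split=> [i|i|i j ij|x Mx h].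
- exact: eM.
- by rewrite eo// eqxx.
- by rewrite eo//; case: eqP => // /val_inj/ij.
- by apply: emax => // i i_n; exact: (h (Ordinal i_n)).
Qed.

(** Within [r], A agrees on the unit ball of H0 with A Q, whose values lie in a sum of two
    finite-dimensional spaces: otherwise both T ∩ E and S ∩ E would be infinite-dimensional and
    could be paired. *)
Lemma no_complement_tb S T PS PT : separable_space V ->
  closed_subspace S -> closed_subspace T ->
  is_orth_proj ip S PS -> is_orth_proj ip T PT -> ~ common_complement S T ->
  totally_bounded ((fun x => PS x - PT x) @` [set x | generic_part ip S T x /\ nrm x <= 1]).
Proof.
move=> hsep hS hT hPS hPT ncc; apply: tb_approx => r r0.
(* [a < 1] is needed for the cut and [a < r^2] makes the error [sqrt a] smaller than [r]. *)
pose a := Num.min 2^-1 (r ^+ 2 / 4).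
have r2 : 0 < r ^+ 2 by rewrite exprn_gt0.
have a0 : 0 < a by rewrite lt_min invr_gt0 ltr0n/= divr_gt0.
have a1 : a < 1 by rewrite gt_min invf_lt1// ltr1n.
have ar : a < r ^+ 2 by rewrite gt_min; apply/orP; right; lra.
have [E [Q [hE hQ [QS QT] Ege Ele]]] := @spectral_cut _ _ ip hip S T PS PT hS hT hPS hPT a a0 a1.
pose H := E `&` generic_part ip S T.
have sI (M N : set V) : subspace M -> subspace N -> subspace (M `&` N).
  move=> hM hN; split; first by split; [exact: hM.1|exact: hN.1].
  by move=> c x y [? ?] [? ?]; split; exact: subZD.
have sH : subspace H.
  apply: sI; first exact: hE.1.
  split; first by split; exact: (orth_subspace _).1.
  by move=> c x y [? ?] [? ?]; split; exact: (orth_subspace _).2.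
have fin : (exists n e, fin_onb ip (T `&` H) n e) /\ (exists n e, fin_onb ip (S `&` H) n e).
  have [[n [e he]]|[e he]] := basis_dichotomy hsep (sI _ _ hT.1 hE.1).
    exact: (cut_fin_onb hS hT hPT hE hQ QT hsep he).
  have [[n [f hf]]|[f hf]] := basis_dichotomy hsep (sI _ _ hS.1 hE.1).
    have := @cut_fin_onb _ _ ip hip T S PS hT hS hPS E Q hE hQ QS n f hsep hf.
    by rewrite generic_partC => -[].
  case: ncc.
  exact: (cut_common_complement hS hT hPS hPT a0 a1 hE hQ QS QT Ege Ele he hf).
have [[n [e he]] [m [f hf]]] := fin.
exists (setsum [set x | (S `&` H) x /\ nrm x <= 1]
  [set - x | x in [set x | (T `&` H) x /\ nrm x <= 1]]).
  by apply: tb_add; [apply: tb_fin hf|apply: tb_opp; apply: tb_fin he]; apply: sI => //;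
    [exact: hS.1|exact: hT.1].
move=> _ [z [Gz z1] <-].
have [SQ TQ] := cut_generic hS hT hPS hPT hE hQ QS QT Gz.
have Qz1 : nrm (Q z) <= 1 by apply: le_trans (proj_le hQ z) z1.
exists (PS (Q z) - PT (Q z)).
  exists (PS (Q z)); first by split=> //; apply: le_trans (proj_le hPS _) Qz1.
  exists (- PT (Q z)) => //; exists (PT (Q z)) => //; split=> //.
  by apply: le_trans (proj_le hPT _) Qz1.
have linQ : lin Q by exact: (proj_lin hE.1 hQ).
have Q0 : Q (z - Q z) = 0 by rewrite linB// (proj_id hE.1 hQ (proj_in hQ z)) subrr.
have linA : lin (proj_diff PS PT) by exact: (proj_diff_lin hS hT hPS hPT).
rewrite -/(proj_diff PS PT z) -/(proj_diff PS PT (Q z)) -linB//.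
have w1 : nrm (z - Q z) ^+ 2 <= 1.
  have : nrm z ^+ 2 <= 1 by rewrite expr_le1 ?nrm_ge0.
  by rewrite (proj_pyth hQ z); have := sqr_ge0 (nrm (Q z)); lra.
rewrite -ltr_sqr ?nnegrE ?nrm_ge0// ?ltW//; apply: le_lt_trans (Ele _ Q0) _.
by apply: le_lt_trans ar; rewrite ler_piMr// ltW.
Qed.

(** Two infinite dimensions, or two equal finite ones, would contradict [nd]; otherwise the smaller
    is some finite [n], the other space has [n + 1] orthonormal vectors, and the Fredholm
    obstruction applies, with [S] and [T] swapped if necessary. *)
Lemma compact_no_complement S T PS PT : separable_space V ->
  closed_subspace S -> closed_subspace T ->
  is_orth_proj ip S PS -> is_orth_proj ip T PT ->
  ~ same_hdim ip (half_orth ip S T) (half_orth ip T S) ->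
  totally_bounded ((fun x => PS x - PT x) @` [set x | generic_part ip S T x /\ nrm x <= 1]) ->
  ~ common_complement S T.
Proof.
move=> hsep hS hT hPS hPT nd tbA cc.
have tbA' : totally_bounded ((fun x => PT x - PS x) @` [set x | generic_part ip T S x /\ nrm x <= 1]).
  apply: tbS (tb_opp tbA) => _ [x [Gx x1] <-]; exists (PS x - PT x); last by rewrite opprB.
  by exists x => //; split=> //; rewrite -generic_partC.
have cc' := common_complementC cc.
have inf_fin (S' T' : set V) PS' PT' n e (f : nat -> V) : closed_subspace S' -> closed_subspace T' ->
    is_orth_proj ip S' PS' -> is_orth_proj ip T' PT' -> common_complement S' T' ->
    totally_bounded ((fun x => PS' x - PT' x) @` [set x | generic_part ip S' T' x /\ nrm x <= 1]) ->
    fin_onb ip (half_orth ip T' S') n e -> orthonormal_basis ip (half_orth ip S' T') f -> False.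
  move=> hS' hT' hPS' hPT' c' t' he [fM f1 fo _].
  apply: (@fredholm_no_complement _ _ ip hip S' T' PS' PT' n e f hS' hT' hPS' hPT' c' t' he) => // i j _ _.
  by have [->|/eqP ij] := eqVneq i j; [rewrite f1|rewrite fo].
have fin_fin (S' T' : set V) PS' PT' n e m f : closed_subspace S' -> closed_subspace T' ->
    is_orth_proj ip S' PS' -> is_orth_proj ip T' PT' -> common_complement S' T' ->
    totally_bounded ((fun x => PS' x - PT' x) @` [set x | generic_part ip S' T' x /\ nrm x <= 1]) ->
    fin_onb ip (half_orth ip T' S') n e -> fin_onb ip (half_orth ip S' T') m f ->
    (n < m)%N -> False.
  move=> hS' hT' hPS' hPT' c' t' he [fM fo _] nm.
  apply: (@fredholm_no_complement _ _ ip hip S' T' PS' PT' n e f hS' hT' hPS' hPT' c' t' he) => [i i_n|i j i_n j_n].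
    by apply: fM; exact: leq_trans i_n nm.
  by apply: fo; [exact: leq_trans i_n nm|exact: leq_trans j_n nm].
have [[n [e he]]|[e he]] := basis_dichotomy hsep (half_orth_subspace S hT.1);
  have [[m [f hf]]|[f hf]] := basis_dichotomy hsep (half_orth_subspace T hS.1).
- have [nm|mn|nm] := ltngtP n m.
  + exact: (fin_fin S T PS PT n e m f).
  + exact: (fin_fin T S PT PS m f n e).
  + apply: nd; rewrite nm in he; exists 'I_m, (fun i : 'I_m => f i), (fun i : 'I_m => e i).
    by split; exact: fin_onb_basis.
- exact: (inf_fin S T PS PT n e f).
- exact: (inf_fin T S PT PS m f e).
- by apply: nd; exists nat, f, e.
Qed.

End Characterization.

Theorem mainTheorem13 (R : realType) (V : completeNormedModType R[i])
  (ip : V -> V -> R[i]) (hip : hilbert_inner ip) (hsep : separable_space V)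
  (S T : set V) (hS : closed_subspace S) (hT : closed_subspace T)
  (PS PT : V -> V) (hPS : is_orth_proj ip S PS) (hPT : is_orth_proj ip T PT) :
  let A := fun x : V => PS x - PT x in
  let N1 := eigspace A 1 in
  let Nm1 := eigspace A (-1) in
  let H0 := orth ip (setsum N1 Nm1) in
  ~ common_complement S T <-> (~ same_hdim ip N1 Nm1 /\ compact_on A H0).
Proof.
move=> A N1 Nm1 H0.
have EN1 : N1 = half_orth ip S T by exact: eigspace1.
have ENm1 : Nm1 = half_orth ip T S by exact: eigspaceN1.
have ball_nrm : [set x | H0 x /\ `|x| <= 1] = [set x | generic_part ip S T x /\ nrm x <= 1].
  rewrite /H0 EN1 ENm1 orth_setsum; last first.
  - exact: (half_orth_subspace S hT.1).1.
  - exact: (half_orth_subspace T hS.1).1.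
  by apply/seteqP; split=> x /=; rewrite normE -lecR.
rewrite /compact_on ball_nrm EN1 ENm1; split=> [ncc|[nd /compact_tb tbA]].
  split; first by move=> /(same_hdim_common_complement hS hT hPS hPT).
  exact/tb_compact/no_complement_tb.
exact: compact_no_complement hsep hS hT hPS hPT nd tbA.
Qed.
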